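(* There exists an absolute constant $K>0$ such that, for every integer $n\ge 1$ and every $A\in M_n(\mathbb{C})$ with $\operatorname{tr}A=0$, there exist $B,C\in M_n(\mathbb{C})$ satisfying $$A=BC-CB,\qquad \lVert B\rVert\,\lVert C\rVert\le K\lVert A\rVert .$$
   Context: $M_n(\mathbb{C})$ is the algebra of complex $n\times n$ matrices, and $\lVert\cdot\rVert$ is the operator norm on $\mathbb{C}^n$ (with the Euclidean norm). The trace is unnormalized. The constant $K$ does not depend on $n$ or $A$. *)

(* Defs.v *)
From mathcomp Require Import all_boot all_order all_algebra.
From mathcomp Require Import complex.
From mathcomp Require Import classical_sets reals.

Set Implicit Arguments.
Unset Strict Implicit.
Unset Printing Implicit Defensive.

Import Order.TTheory GRing.Theory Num.Theory.

Local Open Scope classical_set_scope.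
Local Open Scope ring_scope.

(* [ComplexField.Normc.normc] is the modulus valued in [R]; the norm [`|z|] of the
   field [R[i]] is itself an element of [R[i]], on which [sup] is not defined. *)
Definition l2norm (R : realType) (n : nat) (x : 'cV[R[i]]_n) : R :=
  Num.sqrt (\sum_(i < n) ComplexField.Normc.normc (x i ord0) ^+ 2).

(* The set is nonempty and, the dimension being finite, bounded above, so the
   default value of [sup] is never used. *)
Definition opnorm (R : realType) (n : nat) (A : 'M[R[i]]_n) : R :=
  sup [set l2norm (A *m x) | x in [set x : 'cV[R[i]]_n | l2norm x <= 1]].

(* Main.v *)
Require Import Defs.
From mathcomp Require Import all_boot all_order all_algebra.
From mathcomp Require Import complex.
From mathcomp Require Import classical_sets reals.
From mathcomp Require Import boolp spectral.
From mathcomp Require Import zify ring lra.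

(** The commutator is built with a block-diagonal left factor.  Suppose that
    the identity is a sum of orthogonal projections P_i such that every
    compression P_i A P_i has trace zero.  Choose centers b_i in the complex
    plane and put B = sum (b_i P_i + B_i), with B_i living on the block P_i and
    of norm at most r_i.  If the discs of center b_i and radius r_i are apart,
    the off-diagonal blocks of C come from Sylvester equations
    (b_i + B_i) X - X (b_j + B_j) = P_i A P_j, with a norm controlled by the gaps
    between the discs (sylvester_solution, commutator_assembly).  The diagonal
    blocks of C come from an induction on the rank: rescaling a representation
    of P_i A P_i with left factor of norm at most 1 to a left factor of norm r_i
    yields a right factor of norm at most K |P_i A P_i| / r_i.  The induction
    closes as soon as r_i is a fixed multiple of |P_i A P_i| and the discs fit in
    a bounded region, that is, as soon as the sum of the |P_i A P_i| ^ 2 is small,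
    with a number of blocks that does not depend on the dimension.

    So everything rests on a decomposition into boundedly many trace-zero blocks
    whose squared norms have a small sum (blocks_exist).  It relies on
    three facts, which exploit the freedom in the choice of the basis.

    - A projection P of rank at least 4 j contains one of rank j on which the
      compression of A is a scalar (scalar_compression).  Peeling off such
      projections s times leaves a core carrying (3/4) ^ s of the rank (flag).

    - From a flag, one extracts a fixed fraction of each piece in such a way that
      the extracted pieces are uncoupled: A has no off-diagonal entry between
      them (crossfree_extract).  As the compressions are scalars, and as a
      subprojection of the core can be given its fair share of the trace, both
      the extracted package and the rest still have trace zero.  After a number p
      of extractions proportional to s, the rest is tiny, and it is absorbed in
      the core of the first package (crossfree_absorb).

    - A package splits into 4 ^ h equidimensional uncoupled rows, all but s + 1 of
      them scalar.  Combining these rows with the entries of a Hadamard matrix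
      replaces their compressions by the average of all of them, which has trace
      zero and norm at most 2 (s + 1) / 4 ^ h (row_system_mix).

    With s = 8 h and p = 144 h, there are (p + 1) 4 ^ h such blocks of norm
    O(h / 4 ^ h), and the sum of the squared norms, O(h ^ 3 / 4 ^ h), tends to 0.
    The divisibility constraints on the rank are met by first splitting off a
    bounded number of lines on which A compresses to 0. *)

Set Implicit Arguments.
Unset Strict Implicit.
Unset Printing Implicit Defensive.

Import Order.TTheory GRing.Theory Num.Theory.

(** * Choice of the parameters *)

Lemma double_expn_le k a : (0 < k)%N -> (2 * a ^ k <= (2 * a) ^ k)%N.
Proof.
case: k => // k _; rewrite expnMn leq_mul2r; apply/orP; right.
by rewrite expnS leq_pmulr // expn_gt0.
Qed.

(** The number of packages is p + 1, each is cut into 4 ^ h blocks, and a flag has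
    s scalar pieces.  The second condition makes the core of a package at most
    half of a row, the third one makes the rest small enough to be absorbed, and
    the last one lets the discs of the induction fit in a bounded region. *)
Lemma parameters_exist : exists h s p, [/\ (0 < h)%N, (2 * (4 ^ h * 3 ^ s) <= 4 ^ s)%N,
  (4 ^ s * 7 ^ p.+1 <= 8 ^ p)%N & (48 * (s.+1 * p.+2) <= 2 ^ h)%N].
Proof.
(* h = 4 n, and 2 ^ h >= (n + 1) ^ 4 beats the quadratic left-hand side. *)
have [n nE] : exists n, n.+1 = (48 * 32)%N by exists 1535.
have [N NE] : exists N, N = n.+1 by exists n.+1.
have n3 : (3 <= n)%N by lia.
have [h hE] : exists h, h = (4 * n)%N by exists (4 * n)%N.
have h3 : (3 <= h)%N by lia.
have bound : (48 * ((8 * h).+1 * (144 * h).+2) <= 2 ^ h)%N.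
  apply: (@leq_trans (N * N * (N * N))).
    apply: (@leq_trans (48 * ((32 * N) * (576 * N)))).
      by rewrite leq_mul2l /=; apply: leq_mul; lia.
    rewrite (mulnACA 32 N 576 N) mulnA (mulnA 48 32).
    have N1 : (48 * 32 <= N)%N by rewrite NE nE.
    have N5 : (576 <= N)%N by lia.
    by rewrite leq_mul2r (leq_mul N1 N5) orbT.
  have N2 : (N <= 2 ^ n)%N by rewrite NE; exact: ltn_expl.
  have -> : (2 ^ h = 2 ^ n * 2 ^ n * (2 ^ n * 2 ^ n))%N.
    by rewrite -!expnD hE; congr (2 ^ _); lia.
  by rewrite !leq_mul.
have x3 : (3 ^ 8 = 81 * 81)%N by rewrite (expnD 3 4 4).
have x4 : (4 ^ 8 = 256 * 256)%N by rewrite (expnD 4 4 4).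
have x7 : (7 ^ 6 = 343 * 343)%N by rewrite (expnD 7 3 3).
have x8 : (8 ^ 6 = 512 * 512)%N by rewrite (expnD 8 3 3).
have h0 : (0 < h)%N by apply: leq_trans h3.
exists h, (8 * h)%N, (144 * h)%N; split; first exact: h0; last exact: bound.
- rewrite !expnM -expnMn; apply: leq_trans (double_expn_le (4 * 3 ^ 8) h0) _.
  rewrite leq_exp2r; last exact: h0.
  by rewrite x3 x4; clear; lia.
have [s sE] : exists s, s = (8 * h)%N by exists (8 * h)%N.
have s3 : (3 <= s)%N by lia.
(* 2 * 7 ^ 6 <= 8 ^ 6, so 8 ^ p >= 8 ^ s * 7 ^ p. *)
have -> : (144 * h = 6 * (3 * s))%N by lia.
rewrite -sE; clear bound hE h3 h0 sE NE nE n3.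
rewrite expnS !(expnM _ 6); apply: (@leq_trans ((2 * 7 ^ 6) ^ (3 * s))); last first.
  rewrite leq_exp2r; last by rewrite muln_gt0 (leq_trans _ s3).
  by rewrite x7 x8; clear; lia.
rewrite expnMn mulnA leq_mul2r; apply/orP; right.
clear x3 x4 x7 x8; rewrite expnM (_ : 2 ^ 3 = 2 * 4)%N // expnMn mulnC leq_mul2r; apply/orP; right.
by apply: (@leq_trans (2 ^ 3)) => //; rewrite leq_exp2l.
Qed.

Local Open Scope ring_scope.
Local Open Scope sesquilinear_scope.

(** * Adjoints and orthogonal projections *)

Section Adjoint.
Variable C : numClosedFieldType.

Lemma adjmxM m n p (A : 'M[C]_(m, n)) (B : 'M[C]_(n, p)) :
  (A *m B)^t* = B^t* *m A^t*.
Proof. by rewrite trmx_mul map_mxM. Qed.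

Lemma adjmxD m n (A B : 'M[C]_(m, n)) : (A + B)^t* = A^t* + B^t*.
Proof. by apply/matrixP => i j; rewrite !mxE rmorphD. Qed.

Lemma adjmxN m n (A : 'M[C]_(m, n)) : (- A)^t* = - A^t*.
Proof. by apply/matrixP => i j; rewrite !mxE rmorphN. Qed.

Lemma adjmxB m n (A B : 'M[C]_(m, n)) : (A - B)^t* = A^t* - B^t*.
Proof. by rewrite adjmxD adjmxN. Qed.

Lemma adjmxZ m n (a : C) (A : 'M[C]_(m, n)) : (a *: A)^t* = a^* *: A^t*.
Proof. by apply/matrixP => i j; rewrite !mxE rmorphM. Qed.

Lemma adjmx0 m n : (0 : 'M[C]_(m, n))^t* = 0.
Proof. by apply/matrixP => i j; rewrite !mxE rmorph0. Qed.

Lemma adjmx1 n : (1%:M : 'M[C]_n)^t* = 1%:M.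
Proof. by apply/matrixP => i j; rewrite !mxE eq_sym; case: eqP; rewrite ?rmorph1 ?rmorph0. Qed.

Lemma adjmx_sum m n (I : Type) (r : seq I) (F : I -> 'M[C]_(m, n)) :
  (\sum_(i <- r) F i)^t* = \sum_(i <- r) (F i)^t*.
Proof. by elim/big_rec2: _ => [|i A B _ <-]; rewrite ?adjmx0 ?adjmxD. Qed.

Lemma adjmx_inj m n (A B : 'M[C]_(m, n)) : A^t* = B^t* -> A = B.
Proof. by move=> /(congr1 (fun M => M^t*)); rewrite !trmxCK. Qed.

End Adjoint.

Section Projections.
Variables (C : numClosedFieldType) (n : nat).
Implicit Types P Q A : 'M[C]_n.

(** Subspaces are encoded by their orthogonal projections; [Q *m P = Q] says that
    the range of [Q] lies in the range of [P]. *)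
Definition isproj P : Prop := P^t* = P /\ P *m P = P.

Lemma isproj0 : isproj 0.
Proof. by split; rewrite ?adjmx0 ?mulmx0. Qed.

Lemma isproj1 : isproj 1%:M.
Proof. by split; rewrite ?adjmx1 ?mulmx1. Qed.

Lemma isproj_rows k (W : 'M[C]_(k, n)) : W \is unitarymx -> isproj (W^t* *m W).
Proof.
move=> /unitarymxP uW; split; first by rewrite adjmxM trmxCK.
by rewrite mulmxA -(mulmxA _ W) uW mulmx1.
Qed.

Lemma mxrank_rows k (W : 'M[C]_(k, n)) : W \is unitarymx -> \rank (W^t* *m W) = k.
Proof.
move=> uW; have rW := mxrank_unitary uW; apply/eqP; rewrite eqn_leq.
have := mxrankM_maxr (W^t*) W; rewrite rW => -> /=.
have WE : W = W *m (W^t* *m W) by rewrite mulmxA (unitarymxP uW) mul1mx.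
by have := mxrankM_maxr W (W^t* *m W); rewrite -WE rW.
Qed.

Lemma subprojC P Q : isproj P -> isproj Q -> Q *m P = Q -> P *m Q = Q.
Proof.
move=> [aP _] [aQ _] /(congr1 (fun M => M^t*)).
by rewrite adjmxM aP aQ.
Qed.

Lemma orthoC P Q : isproj P -> isproj Q -> P *m Q = 0 -> Q *m P = 0.
Proof.
move=> [aP _] [aQ _] /(congr1 (fun M => M^t*)).
by rewrite adjmxM aP aQ adjmx0.
Qed.

Lemma isprojD P Q : isproj P -> isproj Q -> P *m Q = 0 -> isproj (P + Q).
Proof.
move=> pP pQ PQ; have QP := orthoC pP pQ PQ.
case: pP pQ => [aP iP] [aQ iQ]; split; first by rewrite adjmxD aP aQ.
by rewrite mulmxDl !mulmxDr iP iQ PQ QP addr0 add0r.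
Qed.

Lemma isprojB P Q : isproj P -> isproj Q -> Q *m P = Q -> isproj (P - Q).
Proof.
move=> pP pQ QP; have PQ := subprojC pP pQ QP.
case: pP pQ => [aP iP] [aQ iQ]; split; first by rewrite adjmxB aP aQ.
by rewrite mulmxBl !mulmxBr iP iQ PQ QP subrr subr0.
Qed.

Lemma subproj_trans P Q m (S : 'M[C]_(m, n)) : Q *m P = Q -> S *m Q = S -> S *m P = S.
Proof. by move=> QP <-; rewrite -mulmxA QP. Qed.

Lemma subprojB_ortho P Q : isproj Q -> Q *m P = Q -> Q *m (P - Q) = 0.
Proof. by move=> [_ iQ] QP; rewrite mulmxBr QP iQ subrr. Qed.

Lemma subprojBl P Q : isproj P -> isproj Q -> Q *m P = Q -> (P - Q) *m P = P - Q.
Proof. by move=> [_ iP] _ QP; rewrite mulmxBl iP QP. Qed.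

(** The range of P meets the kernel of F in dimension at least rank P - rank F; an
    orthonormal basis of a subspace of it is given by Gram-Schmidt. *)
Lemma rows_in_kernel P l (F : 'M[C]_(n, l)) j :
  isproj P -> (j + \rank F <= \rank P)%N ->
  exists W : 'M[C]_(j, n), [/\ W \is unitarymx, W *m P = W & W *m F = 0].
Proof.
move=> [aP iP] jr; pose S := (P :&: kermx F)%MS.
have rS : (j <= \rank S)%N.
  have := mxrank_sum_cap P (kermx F); rewrite mxrank_ker -/S.
  have := rank_leq_col (P + kermx F)%MS; have := rank_leq_row F.
  move: (\rank S) (\rank F) (\rank P) (\rank _) jr => a b c d; lia.
pose G := row_base S; pose U := schmidt G.
have rn : (\rank S <= n)%N by exact: rank_leq_col.
have uU : U \is unitarymx by exact: schmidt_unitarymx.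
have eU : (U :=: S)%MS.
  by apply: eqmx_trans (eq_row_base S); apply: eqmx_schmidt_free; rewrite // row_base_free.
pose W : 'M[C]_(j, n) := \matrix_(i < j) row (widen_ord rS i) U.
have WU : (W <= U)%MS by apply/row_subP => i; rewrite rowK row_sub.
have WS : (W <= S)%MS by apply: submx_trans WU _; rewrite eU.
exists W; split.
- apply/row_unitarymxP => i k; rewrite !rowK; have /row_unitarymxP -> := uU.
  by congr (_%:R); rewrite -!val_eqE.
- have /submxP[Z ->] := submx_trans WS (capmxSl _ _).
  by rewrite -mulmxA iP.
- exact/sub_kermxP/(submx_trans WS)/capmxSr.
Qed.

Lemma rows_of_proj P : isproj P ->
  exists V : 'M[C]_(\rank P, n), V \is unitarymx /\ V^t* *m V = P.
Proof.
move=> pP; have [|W [uW WP _]] := @rows_in_kernel P 0 0 (\rank P) pP.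
  by rewrite mxrank0 addn0.
exists W; split=> //; have [aP iP] := pP.
set Q := W^t* *m W; have QP : Q *m P = Q by rewrite -mulmxA WP.
have /submxP[Z PZ] : (P <= Q)%MS.
  by rewrite -(geq_leqif (mxrank_leqif_sup _)) ?mxrank_rows // -QP submxMl.
have [_ iQ] : isproj Q by exact: isproj_rows.
have PQ : P *m Q = Q by apply: subprojC => //; exact: isproj_rows.
by rewrite -PQ PZ -mulmxA iQ.
Qed.

Lemma mxtrace_proj P : isproj P -> \tr P = (\rank P)%:R.
Proof.
move=> /rows_of_proj [V [/unitarymxP uV VP]].
by rewrite -{1}VP mxtrace_mulC uV mxtrace1.
Qed.

Lemma mxrank_projD P Q : isproj P -> isproj Q -> P *m Q = 0 ->
  \rank (P + Q)%R = (\rank P + \rank Q)%N.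
Proof.
move=> pP pQ PQ; have := mxtrace_proj (isprojD pP pQ PQ).
rewrite mxtraceD !mxtrace_proj // -natrD => /eqP.
by rewrite eqr_nat => /eqP ->.
Qed.

Lemma mxrank_projB P Q : isproj P -> isproj Q -> Q *m P = Q ->
  \rank (P - Q) = (\rank P - \rank Q)%N.
Proof.
move=> pP pQ QP.
have := mxrank_projD pQ (isprojB pP pQ QP) (subprojB_ortho pQ QP).
by rewrite addrC subrK => ->; rewrite addKn.
Qed.

Lemma mxrank_subproj P Q : Q *m P = Q -> (\rank Q <= \rank P)%N.
Proof. by move=> <-; exact: mxrankM_maxr. Qed.

Lemma subproj_in_kernel P l (F : 'M[C]_(n, l)) j :
  isproj P -> (j + \rank F <= \rank P)%N ->
  exists Q, [/\ isproj Q, Q *m P = Q, Q *m F = 0 & \rank Q = j].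
Proof.
move=> pP jr; have [W [uW WP WF]] := rows_in_kernel pP jr.
exists (W^t* *m W); split; first exact: isproj_rows.
- by rewrite -mulmxA WP.
- by rewrite -mulmxA WF mulmx0.
- exact: mxrank_rows.
Qed.

Lemma subproj_of_rank P j : isproj P -> (j <= \rank P)%N ->
  exists Q, [/\ isproj Q, Q *m P = Q & \rank Q = j].
Proof.
move=> pP jP; have [|Q [pQ QP _ rQ]] := @subproj_in_kernel P 0 0 j pP.
  by rewrite mxrank0 addn0.
by exists Q.
Qed.

(** Being uncoupled from E costs at most 2 rank E dimensions: Q has to annihilate
    both A E and A^* E. *)
Lemma subproj_uncoupled A P E j :
  isproj P -> isproj E -> (j + 2 * \rank E <= \rank P)%N ->
  exists Q, [/\ isproj Q, Q *m P = Q, \rank Q = j & Q *m A *m E = 0 /\ E *m A *m Q = 0].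
Proof.
move=> pP pE jr; pose F := row_mx (A *m E) (A^t* *m E).
have rF : (\rank F <= 2 * \rank E)%N.
  rewrite -mxrank_tr tr_row_mx -addsmxE mul2n -addnn.
  apply: leq_trans (mxrank_adds_leqif _ _) _.
  by rewrite !mxrank_tr leq_add ?mxrankM_maxr.
have [|Q [pQ QP QF rQ]] := @subproj_in_kernel P _ F j pP.
  by apply: leq_trans jr; rewrite leq_add2l.
exists Q; split=> //; move: QF; rewrite mul_mx_row.
rewrite -row_mx0 => /eq_row_mx [QAE QAE']; split; first by rewrite -mulmxA.
apply: adjmx_inj; rewrite !adjmxM adjmx0; have [-> _] := pE; have [-> _] := pQ.
exact: QAE'.
Qed.
End Projections.

(** * Numerical range and scalar compressions *)

Section NumericalRange.
Variables (C : numClosedFieldType) (n : nat).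
Implicit Types (P Q A : 'M[C]_n) (u v w : 'rV[C]_n).

Definition sform A u v : C := (u *m A *m v^t*) 0 0.

Lemma sformDl A u v w : sform A (u + v) w = sform A u w + sform A v w.
Proof. by rewrite /sform !mulmxDl mxE. Qed.

Lemma sformDr A u v w : sform A u (v + w) = sform A u v + sform A u w.
Proof. by rewrite /sform adjmxD mulmxDr mxE. Qed.

Lemma sformZl A a u v : sform A (a *: u) v = a * sform A u v.
Proof. by rewrite /sform -!scalemxAl mxE. Qed.

Lemma sformZr A a u v : sform A u (a *: v) = a^* * sform A u v.
Proof. by rewrite /sform adjmxZ -scalemxAr mxE. Qed.

Definition sformE := (sformDl, sformDr, sformZl, sformZr).

Lemma sform1E u v : sform 1%:M u v = (u *m v^t*) 0 0.
Proof. by rewrite /sform mulmx1. Qed.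

Lemma real_quadratic_root (t c : C) : 0 <= t < 1 -> c \is Num.real ->
  exists2 x, x \is Num.real & (1 - t) * x ^+ 2 + c * x - t = 0.
Proof.
move=> /andP[t0 t1] cR; have tR := ger0_real t0.
have t1' : 1 - t != 0 by rewrite subr_eq0 gt_eqF.
pose d := sqrtC (c ^+ 2 + 4 * t * (1 - t)).
have d0 : 0 <= c ^+ 2 + 4 * t * (1 - t).
  by rewrite addr_ge0 ?real_exprn_even_ge0 // !mulr_ge0 ?subr_ge0 ?ler0n // ltW.
have dR : d \is Num.real by rewrite ger0_real ?sqrtC_ge0.
have dE : d ^+ 2 = c ^+ 2 + 4 * t * (1 - t) by rewrite sqrtCK.
exists ((d - c) / (2 * (1 - t))).
  by rewrite realM ?realV ?realM ?realB ?real1 ?realn.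
have -> : (1 - t) * ((d - c) / (2 * (1 - t))) ^+ 2 + c * ((d - c) / (2 * (1 - t))) - t
  = (d ^+ 2 - (c ^+ 2 + 4 * t * (1 - t))) / (4 * (1 - t)).
  by field.
by rewrite dE subrr mul0r.
Qed.

(** The phase that makes the two cross terms of a quadratic form add up to a real
    number. *)
Lemma unit_phase (d : C) : exists2 w, w * w^* = 1 & w * d^* = w^* * d.
Proof.
have [->|d0] := eqVneq d 0.
  by exists 1; rewrite rmorph1 ?mulr1 // rmorph0.
have n0 : `|d| != 0 by rewrite normr_eq0.
have nR : (`|d|^-1)^* = `|d|^-1 by rewrite fmorphV /= conj_normC.
exists (d / `|d|); rewrite rmorphM /= nR; last by ring.
rewrite mulrACA -normCK -expr2 -exprMn divff ?expr1n //.
Qed.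

(** Toeplitz-Hausdorff on an orthonormal pair.  After an affine change of A the two
    values are 0 and 1; with v rotated by the right phase, the value of A along
    u + s v is a real function of the real number s, and hitting t is a
    quadratic equation. *)
Lemma sform_convex A u v (t : C) : 0 <= t < 1 ->
  sform 1%:M u u = 1 -> sform 1%:M v v = 1 ->
  sform 1%:M u v = 0 -> sform 1%:M v u = 0 ->
  exists w, [/\ sform 1%:M w w = 1,
    sform A w w = (1 - t) * sform A u u + t * sform A v v
    & exists a b, w = a *: u + b *: v].
Proof.
move=> t01 uu vv uv vu; set a := sform A u u; set b := sform A v v.
have [<-|neq] := eqVneq a b.
  exists u; split=> //; first by rewrite -mulrDl subrK mul1r.
  by exists 1, 0; rewrite scale1r scale0r addr0.
have ba : b - a != 0 by rewrite subr_eq0 eq_sym.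
have [x xE] : exists x, sform A u v = x * (b - a).
  by exists (sform A u v / (b - a)); rewrite mulfVK.
have [y yE] : exists y, sform A v u = y * (b - a).
  by exists (sform A v u / (b - a)); rewrite mulfVK.
have [w ww wd] := unit_phase (x - y^*).
pose c := w^* * x + w * y.
have cR : c \is Num.real.
  apply/CrealP; rewrite /c rmorphD !rmorphM /= conjCK.
  move: wd; rewrite rmorphB /= conjCK => wd.
  have -> : w * x^* + w^* * y^* = w * (x^* - y) + w * y + w^* * y^* by ring.
  by rewrite wd; ring.
have [s sR sE] := real_quadratic_root t01 cR.
have sC : s^* = s by apply/CrealP.
have p0 : 0 < 1 + s ^+ 2 by rewrite ltr_wpDr ?real_exprn_even_ge0.
pose d := sqrtC (1 + s ^+ 2).
have d0 : d != 0 by rewrite sqrtC_eq0 gt_eqF.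
have dE : d ^+ 2 = 1 + s ^+ 2 by rewrite sqrtCK.
have dV : (d^-1)^* = d^-1.
  by rewrite fmorphV /=; congr _^-1; apply/CrealP; rewrite ger0_real // sqrtC_ge0 ltW.
exists (d^-1 *: (u + (s * w) *: v)); split.
- rewrite !sformE uu vv uv vu dV rmorphM /= sC.
  transitivity (d^-1 ^+ 2 * (1 + s ^+ 2 * (w * w^*))); first by ring.
  by rewrite ww mulr1 -dE exprVn mulVf // expf_neq0.
- rewrite !sformE -/a -/b xE yE dV rmorphM /= sC.
  transitivity (d^-1 ^+ 2 * (a + s * c * (b - a) + s ^+ 2 * (w * w^*) * b)).
    by rewrite /c; ring.
  rewrite ww mulr1 exprVn; apply: (mulfI (expf_neq0 2 d0)).
  rewrite mulVKf ?expf_neq0 // dE.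
  apply/eqP; rewrite -subr_eq0; apply/eqP.
  transitivity ((b - a) * ((1 - t) * s ^+ 2 + c * s - t)); first by ring.
  by rewrite sE mulr0.
- by exists d^-1, (d^-1 * (s * w)); rewrite scalerDr scalerA.
Qed.

Lemma mxtrace_row A (w : 'rV[C]_n) : \tr (w^t* *m w *m A) = sform A w w.
Proof. by rewrite -mulmxA mxtrace_mulC /mxtrace big_ord1. Qed.

(** By induction on the rank: the mean over P is a convex combination of the value
    at one vector and of the mean over its orthogonal complement. *)
Lemma mean_in_numerical_range A P : isproj P -> (0 < \rank P)%N ->
  exists w, [/\ w \is unitarymx, w *m P = w
    & sform A w w = \tr (P *m A) / (\rank P)%:R].
Proof.
move rP: (\rank P) => k; case: k rP => // k; elim: k P => [|k IH] P rP pP _.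
  have [V [uV VP]] := rows_of_proj pP; rewrite rP in V uV VP.
  exists V; split=> //; last by rewrite divr1 -VP mxtrace_row.
  by rewrite -VP mulmxA (unitarymxP uV) mul1mx.
have [|u [uu uP _]] := @rows_in_kernel C n P 0 0 1 pP; first by rewrite mxrank0 rP.
pose E := u^t* *m u; have pE : isproj E by exact: isproj_rows.
have EP : E *m P = E by rewrite -mulmxA uP.
have rPE : \rank (P - E) = k.+1 by rewrite mxrank_projB // rP mxrank_rows // subn1.
have [v [uv vPE vA]] := IH _ rPE (isprojB pP pE EP) isT.
have vE : v *m E = 0.
  rewrite -vPE -mulmxA; have [_ iE] := pE.
  by rewrite mulmxBl (subprojC pP pE EP) iE subrr mulmx0.
have vP : v *m P = v.
  by rewrite -{2}vPE mulmxBr vE subr0.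
have un (w : 'rV[C]_n) : w \is unitarymx -> sform 1%:M w w = 1.
  by move=> /unitarymxP; rewrite sform1E => ->; rewrite mxE.
have vu : v *m u^t* = 0.
  have : v *m E *m u^t* = 0 by rewrite vE mul0mx.
  by rewrite /E -!mulmxA (unitarymxP uu) mulmx1.
have uv0 : u *m v^t* = 0 by apply: adjmx_inj; rewrite adjmxM trmxCK vu adjmx0.
have [||||| w [w1 wA [a [b wE]]]] := @sform_convex A u v (k.+1%:R / k.+2%:R); rewrite ?un //.
- by rewrite divr_ge0 //= ltr_pdivrMr ?ltr0n // mul1r ltr_nat.
- by rewrite sform1E uv0 mxE.
- by rewrite sform1E vu mxE.
exists w; split.
- apply/unitarymxP/matrixP => i j; rewrite !ord1 [RHS]mxE.
  by move: w1; rewrite sform1E.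
- by rewrite wE mulmxDl -!scalemxAl uP vP.
- rewrite wA vA mulmxBl linearB /= mxtrace_row.
  have k1 : k.+1%:R != 0 :> C by rewrite pnatr_eq0.
  have k2 : k.+2%:R != 0 :> C by rewrite pnatr_eq0.
  have e : k.+2%:R = k.+1%:R + 1 :> C by rewrite -natr1.
  move: k1 k2; rewrite e; move: (k.+1%:R) => z z0 z1.
  field; by rewrite ?z0 ?z1.
Qed.

(** Removing a vector at which A takes its mean value does not change the mean over
    the rest, so vectors can be collected one by one. *)
Lemma subproj_mean_trace A P j : isproj P -> (j <= \rank P)%N ->
  exists Q, [/\ isproj Q, Q *m P = Q, \rank Q = j
    & \tr (Q *m A) * (\rank P)%:R = j%:R * \tr (P *m A)].
Proof.
move=> pP; elim: j => [|j IH] jP.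
  by exists 0; split; rewrite ?mul0mx ?mxrank0 ?mxtrace0 ?mul0r //; exact: isproj0.
have [Q [pQ QP rQ tQ]] := IH (ltnW jP).
have rPQ : \rank (P - Q) = (\rank P - j)%N by rewrite mxrank_projB // rQ.
have pPQ := isprojB pP pQ QP.
have [|w [uw wPQ wA]] := @mean_in_numerical_range A _ pPQ.
  by rewrite rPQ subn_gt0.
pose E := w^t* *m w; have pE : isproj E by exact: isproj_rows.
have wQ : w *m Q = 0.
  rewrite -wPQ -mulmxA; have [_ iQ] := pQ.
  by rewrite mulmxBl (subprojC pP pQ QP) iQ subrr mulmx0.
have wP : w *m P = w by rewrite -{2}wPQ mulmxBr wQ subr0.
have EQ : E *m Q = 0 by rewrite -mulmxA wQ mulmx0.
have QE := orthoC pE pQ EQ.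
exists (Q + E); split; first exact: isprojD.
- by rewrite mulmxDl QP -mulmxA wP.
- by rewrite mxrank_projD // rQ mxrank_rows // addn1.
rewrite mulmxDl linearD /= mxtrace_row wA rPQ mulmxBl linearB /= mulrDl tQ.
have d0 : (\rank P - j)%:R != 0 :> C by rewrite pnatr_eq0 subn_eq0 -ltnNge.
have k0 : (\rank P)%:R != 0 :> C by rewrite pnatr_eq0 -lt0n (leq_ltn_trans _ jP).
have dE : (\rank P)%:R = (\rank P - j)%:R + j%:R :> C by rewrite -natrD subnK // ltnW.
apply: (mulfI d0); rewrite mulrDr.
have -> : (\rank P - j)%:R * ((\tr (P *m A) - \tr (Q *m A)) / (\rank P - j)%:R * (\rank P)%:R)
  = \tr (P *m A) * (\rank P)%:R - \tr (Q *m A) * (\rank P)%:R by field.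
by rewrite tQ -natr1 {1}dE; ring.
Qed.

(** The weights that mix two eigenvectors, with eigenvalues on both sides of h, into
    a unit vector on which the value is h. *)
Lemma squared_weights (a b h : C) : a \is Num.real -> b \is Num.real -> b <= h <= a ->
  exists c e, [/\ c^* = c, e^* = e, c ^+ 2 + e ^+ 2 = 1 & c ^+ 2 * a + e ^+ 2 * b = h].
Proof.
move=> aR bR /andP[bh ha]; have [ab|ab] := eqVneq a b.
  exists 1, 0; split; rewrite ?rmorph1 ?rmorph0 //; first by ring.
  have -> : h = b by apply/le_anti; rewrite bh -ab ha.
  by rewrite -ab; ring.
have d0 : 0 < a - b.
  by rewrite subr_gt0 lt_def ab (le_trans bh).
exists (sqrtC ((h - b) / (a - b))), (sqrtC ((a - h) / (a - b))).
have c0 : 0 <= (h - b) / (a - b) by apply: divr_ge0; rewrite ?(ltW d0) ?subr_ge0.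
have e0 : 0 <= (a - h) / (a - b) by apply: divr_ge0; rewrite ?(ltW d0) ?subr_ge0.
have dn : a - b != 0 by rewrite gt_eqF.
split; rewrite ?sqrtCK.
- by apply/CrealP/ger0_real; rewrite sqrtC_ge0.
- by apply/CrealP/ger0_real; rewrite sqrtC_ge0.
- by field.
- by field.
Qed.

(** Take for h a median of the eigenvalues and pair the t-th largest eigenvalue with
    the t-th smallest one: the span of each pair contains a unit vector of value h,
    and vectors from different pairs are orthogonal and uncoupled. *)
Lemma hermitian_scalar_compression A P j : A^t* = A -> isproj P ->
  (2 * j <= \rank P)%N ->
  exists h Q, [/\ isproj Q, Q *m P = Q, \rank Q = j & Q *m A *m Q = h *: Q].
Proof.
move=> aA pP; case: j => [|j] jP.
  exists 0, 0; split; rewrite ?mul0mx ?mxrank0 ?mulmx0 ?scaler0 //; exact: isproj0.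
have {jP} [k jk [V [uV VP]]] : exists2 k : nat, (2 * j.+1 <= k)%N &
    exists V : 'M[C]_(k, n), V \is unitarymx /\ V^t* *m V = P.
  by exists (\rank P) => //; exact: rows_of_proj.
pose S := V *m A *m V^t*.
have hS : S \is hermsymmx.
  by apply/is_hermitianmxP; rewrite expr0 scale1r !adjmxM trmxCK aA mulmxA.
pose U := spectralmx S; have uU : U \is unitarymx := spectral_unitarymx S.
pose d := spectral_diag S.
have dR i : d 0 i \is Num.real by move/mxOverP: (hermitian_spectral_diag_real hS); apply.
pose W := U *m V; have uW : W \is unitarymx by exact: mul_unitarymx.
have WA : W *m A *m W^t* = diag_mx d.
  have /orthomx_spectralP SE := hermitian_normalmx hS.
  have -> : W *m A *m W^t* = U *m S *m U^t* by rewrite /W adjmxM !mulmxA.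
  rewrite SE invmx_unitary // !mulmxA (unitarymxP uU) mul1mx.
  by rewrite -mulmxA (unitarymxP uU) mulmx1.
pose r i l := d 0 l <= d 0 i.
have rT : total r by move=> i l; apply: real_leVge.
have rtr : transitive r by move=> x y z /[swap]; apply: le_trans.
have rrf : reflexive r by move=> x; apply: lexx.
have k0 : (0 < k)%N by apply: leq_trans jk; rewrite muln_gt0.
pose i0 := Ordinal k0; pose s := sort r (enum 'I_k).
have ss : size s = k by rewrite size_sort size_enum_ord.
have us : uniq s by rewrite sort_uniq enum_uniq.
have srt : sorted r s by apply: sort_sorted.
pose x t := nth i0 s t.
have xr (t u : nat) : (t <= u)%N -> (u < k)%N -> d 0 (x u) <= d 0 (x t).
  move=> tu uk; apply: (@sorted_leq_nth _ r rtr rrf i0 s srt); rewrite ?inE ?ss //.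
  exact: leq_ltn_trans uk.
have xe (t u : nat) : (t < k)%N -> (u < k)%N -> (x t == x u) = (t == u).
  by move=> tk uk; rewrite nth_uniq ?ss.
(* The first j.+1 eigenvalues are at least h and the last j.+1 are at most h. *)
pose h := d 0 (x j).
have mix (t : 'I_j.+1) : exists ce : C * C, [/\ ce.1^* = ce.1, ce.2^* = ce.2,
    ce.1 ^+ 2 + ce.2 ^+ 2 = 1
    & ce.1 ^+ 2 * d 0 (x t) + ce.2 ^+ 2 * d 0 (x (k.-1 - t)%N) = h].
  have [|||c [e [? ? ? ?]]] := @squared_weights (d 0 (x t)) (d 0 (x (k.-1 - t)%N)) h;
    [exact: dR | exact: dR | | by exists (c, e)].
  have tj := ltn_ord t.
  by apply/andP; split; apply: xr; lia.
have [ce ceP] := fin_all_exists mix.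
pose T := \matrix_(t < j.+1) ((ce t).1 *: row (x t) W + (ce t).2 *: row (x (k.-1 - t)%N) W).
have W1 a b : sform 1%:M (row a W) (row b W) = (a == b)%:R.
  rewrite sform1E; have /unitarymxP/matrixP/(_ a b) := uW.
  by rewrite !mxE => <-; apply: eq_bigr => i _; rewrite !mxE.
have WA' a b : sform A (row a W) (row b W) = d 0 a *+ (a == b).
  have <- : (W *m A *m W^t*) a b = d 0 a *+ (a == b) by rewrite WA mxE.
  rewrite /sform -row_mul mxE [RHS]mxE; apply: eq_bigr => i _; rewrite !mxE //.
have T1 (t u : 'I_j.+1) : sform 1%:M (row t T) (row u T) = (t == u)%:R.
  have [c1 c2 c3 c4] := ceP t; have [e1 e2 e3 e4] := ceP u.
  have tj := ltn_ord t; have uj := ltn_ord u.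
  rewrite !rowK !sformE !W1 e1 e2 !xe; try lia.
  have -> : (t == (k.-1 - u)%N :> nat) = false by lia.
  have -> : ((k.-1 - t)%N == u :> nat) = false by lia.
  have -> : ((k.-1 - t)%N == (k.-1 - u)%N :> nat) = (t == u) by rewrite -val_eqE /=; lia.
  rewrite -val_eqE; case: eqP => [/val_inj ->|_] /=; last by ring.
  by transitivity ((ce u).1 ^+ 2 + (ce u).2 ^+ 2); [ring | rewrite e3].
have TA (t u : 'I_j.+1) : sform A (row t T) (row u T) = h * (t == u)%:R.
  have [c1 c2 c3 c4] := ceP t; have [e1 e2 e3 e4] := ceP u.
  have tj := ltn_ord t; have uj := ltn_ord u.
  rewrite !rowK !sformE !WA' e1 e2 !xe; try lia.
  have -> : (t == (k.-1 - u)%N :> nat) = false by lia.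
  have -> : ((k.-1 - t)%N == u :> nat) = false by lia.
  have -> : ((k.-1 - t)%N == (k.-1 - u)%N :> nat) = (t == u) by rewrite -val_eqE /=; lia.
  rewrite -val_eqE; case: eqP => [/val_inj ->|_] /=; last by ring.
  by rewrite -e4; ring.
have uT : T \is unitarymx.
  apply/unitarymxP/matrixP => t u; rewrite [RHS]mxE -T1 sform1E !mxE.
  by apply: eq_bigr => i _; rewrite !mxE.
have TTA : T *m A *m T^t* = h%:M.
  apply/matrixP => t u; rewrite [RHS]mxE -mulr_natr -TA /sform -row_mul !mxE.
  by apply: eq_bigr => i _; rewrite !mxE.
have TP : T *m P = T.
  apply/row_matrixP => t; rewrite row_mul !rowK mulmxDl -!scalemxAl -!row_mul.
  by rewrite /W -mulmxA -VP (mulmxA V) (unitarymxP uV) mul1mx.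
exists h, (T^t* *m T); split.
- exact: isproj_rows.
- by rewrite -mulmxA TP.
- exact: mxrank_rows.
rewrite -!mulmxA (mulmxA T A) (mulmxA (T *m A)) TTA mul_scalar_mx.
by rewrite -scalemxAr.
Qed.

(** The Hermitian part costs a factor 2 in the rank, and the skew-Hermitian part
    another one. *)
Lemma scalar_compression A P j : isproj P -> (4 * j <= \rank P)%N ->
  exists l Q, [/\ isproj Q, Q *m P = Q, \rank Q = j & Q *m A *m Q = l *: Q].
Proof.
move=> pP jP; pose H := A + A^t*; pose G := 'i *: (A - A^t*).
have aH : H^t* = H by rewrite adjmxD trmxCK addrC.
have aG : G^t* = G by rewrite adjmxZ adjmxB trmxCK conjCi scaleNr -scalerN opprB.
have [|h [Q1 [p1 QP1 r1 QH]]] := @hermitian_scalar_compression H P (2 * j) aH pP; first lia.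
have [|g [Q [p QQ r QG]]] := @hermitian_scalar_compression G Q1 j aG p1; first by rewrite r1.
exists (2^-1 * (h - 'i * g)), Q; split=> //; first exact: subproj_trans QP1 QQ.
have QH' : Q *m H *m Q = h *: Q.
  have QC := subprojC p1 p QQ.
  transitivity (Q *m (Q1 *m H *m Q1) *m Q); first by rewrite !mulmxA QQ -[RHS]mulmxA QC.
  by rewrite QH -scalemxAr -scalemxAl QQ; have [_ ->] := p.
have -> : A = 2^-1 *: (H - 'i *: G).
  rewrite scalerA -expr2 sqrCi scaleN1r opprK addrACA subrr addr0 -mulr2n.
  by rewrite -scaler_nat scalerA mulVf ?scale1r // pnatr_eq0.
rewrite -scalemxAr -scalemxAl mulmxBr mulmxBl -scalemxAr -scalemxAl QH' QG.
by rewrite scalerA -scalerBl scalerA.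
Qed.

End NumericalRange.

(** * Flags and uncoupled packages *)

Section Packages.
Variables (C : numClosedFieldType) (n : nat) (A : 'M[C]_n).
Implicit Types (P Q E U M L Y Z : 'M[C]_n).

Lemma ortho_sub P Q P' Q' : isproj Q -> isproj Q' ->
  P' *m P = P' -> Q' *m Q = Q' -> P *m Q = 0 -> P' *m Q' = 0.
Proof.
move=> pQ pQ' PP QQ PQ.
by rewrite -PP -(subprojC pQ pQ' QQ) mulmxA -(mulmxA P') PQ mulmx0 mul0mx.
Qed.

(** A has no entry between the two orthogonal ranges, so that compressing A to their
    sum gives a direct sum. *)
Definition uncoupled P Q := [/\ P *m Q = 0, P *m A *m Q = 0 & Q *m A *m P = 0].

Lemma uncoupledC P Q : isproj P -> isproj Q -> uncoupled P Q -> uncoupled Q P.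
Proof. by move=> pP pQ [o PQ QP]; split=> //; exact: orthoC. Qed.

Lemma uncoupled0 P : uncoupled P 0.
Proof. by split; rewrite ?mulmx0 ?mul0mx. Qed.

Lemma uncoupledD P Q Q' : uncoupled P Q -> uncoupled P Q' -> uncoupled P (Q + Q').
Proof.
by move=> [a b c] [a' b' c']; split; rewrite ?mulmxDr ?mulmxDl ?a ?b ?c ?a' ?b' ?c' addr0.
Qed.

Lemma uncoupled_sub P Q P' Q' : isproj P -> isproj P' -> isproj Q -> isproj Q' ->
  P' *m P = P' -> Q' *m Q = Q' -> uncoupled P Q -> uncoupled P' Q'.
Proof.
move=> pP pP' pQ pQ' PP QQ [o PAQ QAP].
have PC := subprojC pP pP' PP; have QC := subprojC pQ pQ' QQ.
split; first exact: ortho_sub PP QQ o.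
- transitivity (P' *m (P *m A *m Q) *m Q'); last by rewrite PAQ mulmx0 mul0mx.
  by rewrite !mulmxA PP -[RHS]mulmxA QC.
- transitivity (Q' *m (Q *m A *m P) *m P'); last by rewrite QAP mulmx0 mul0mx.
  by rewrite !mulmxA QQ -[RHS]mulmxA PC.
Qed.

Definition scalar_on P := exists l, P *m A *m P = l *: P.

Lemma scalar_on_sub P Q : isproj P -> isproj Q -> Q *m P = Q -> scalar_on P -> scalar_on Q.
Proof.
move=> pP pQ QP [l Pl]; exists l; have PQ := subprojC pP pQ QP.
transitivity (Q *m (P *m A *m P) *m Q); first by rewrite !mulmxA QP -[RHS]mulmxA PQ.
by rewrite Pl -scalemxAr -scalemxAl QP; have [_ ->] := pQ.
Qed.

Lemma scalar_on0 : scalar_on 0.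
Proof. by exists 0; rewrite mulmx0 scaler0. Qed.

(** Inside a projection on which A is scalar, orthogonality is enough. *)
Lemma scalar_on_uncoupled P Q Q' : isproj P -> isproj Q -> isproj Q' ->
  scalar_on P -> Q *m P = Q -> Q' *m P = Q' -> Q *m Q' = 0 -> uncoupled Q Q'.
Proof.
move=> pP pQ pQ' [l Pl] QP QP' o; have o' := orthoC pQ pQ' o.
have cut X Y : X *m P = X -> P *m Y = Y -> X *m Y = 0 -> X *m A *m Y = 0.
  move=> XP PY XY; transitivity (X *m (P *m A *m P) *m Y).
    by rewrite !mulmxA XP -[RHS]mulmxA PY.
  by rewrite Pl -scalemxAr -scalemxAl XP XY scaler0.
by split=> //; apply: cut => //; apply: subprojC.
Qed.

(** A projection of rank 4 ^ s x, cut into s pieces on which A is scalar and a core of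
    rank 3 ^ s x; each piece has a quarter of the rank from which it is
    cut off.  The pieces are orthogonal but may be coupled by A. *)
Fixpoint flag (s x : nat) P : Prop :=
  if s is s'.+1 then
    exists Q P', [/\ isproj Q, \rank Q = (4 ^ s' * x)%N, scalar_on Q,
                     flag s' (3 * x)%N P' & Q *m P' = 0 /\ P = Q + P']
  else isproj P /\ \rank P = x.

Lemma flag_proj s x P : flag s x P -> isproj P /\ \rank P = (4 ^ s * x)%N.
Proof.
elim: s x P => [|s IH] x P /=; first by rewrite mul1n.
move=> [Q [P' [pQ rQ _ /IH[pP' rP'] [o ->]]]]; split; first exact: isprojD.
by rewrite mxrank_projD // rQ rP' expnS; lia.
Qed.

Lemma flag_exists s x P : isproj P -> \rank P = (4 ^ s * x)%N -> flag s x P.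
Proof.
elim: s x P => [|s IH] x P pP; first by rewrite mul1n.
move=> rP /=; have [|l [Q [pQ QP rQ Ql]]] := @scalar_compression _ _ A P (4 ^ s * x) pP.
  by rewrite rP expnS; lia.
have pPQ := isprojB pP pQ QP.
exists Q, (P - Q); split=> //; first by exists l.
  by apply: IH => //; rewrite mxrank_projB // rQ rP expnS; lia.
by split; [exact: subprojB_ortho | rewrite addrC subrK].
Qed.

(** A core M and s scalar pieces, all of them uncoupled from each other: the
    compression of A to E is the direct sum of its compression to M and of s
    scalar matrices. *)
Fixpoint crossfree (s : nat) M E : Prop :=
  if s is s'.+1 then
    exists U E', [/\ isproj U, scalar_on U, crossfree s' M E', uncoupled U E' & E = U + E']
  else isproj M /\ E = M.

Lemma crossfree_proj s M E : crossfree s M E -> isproj E.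
Proof.
elim: s E => [|s IH] E /=; first by move=> [pM ->].
by move=> [U [E' [pU _ /IH pE' [o _ _] ->]]]; exact: isprojD.
Qed.

Lemma crossfree0 s : crossfree s 0 0.
Proof.
elim: s => [|s IH] /=; first by split=> //; exact: isproj0.
exists 0, 0; split=> //; rewrite ?addr0 //; first exact: isproj0.
- exact: scalar_on0.
- exact: uncoupled0.
Qed.

(** An eighth of each piece is taken, starting from the core and going up to the
    largest piece.  When the piece Q is reached, what has been taken below has rank
    3/8 of the rank of Q, so uncoupling from it costs 6/8 of Q, and 2/8 remain.
    A subprojection of a scalar piece carries its exact share of the trace, and in
    the core this is arranged by [subproj_mean_trace]. *)
Lemma crossfree_extract s y P : flag s (8 * y)%N P ->
  exists M E, [/\ crossfree s M E, \rank M = (3 ^ s * y)%N /\ \rank E = (4 ^ s * y)%N,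
    E *m P = E, flag s (7 * y)%N (P - E) & 8 * \tr (E *m A) = \tr (P *m A)].
Proof.
elim: s y P => [|s IH] y P /=.
  move=> [pP rP]; have [|E [pE EP rE tE]] := @subproj_mean_trace _ _ A P y pP; first lia.
  exists E, E; split; rewrite ?mul1n //; first split.
  - exact: isprojB.
  - by rewrite mxrank_projB // rP rE; lia.
  have [y0|y0] := posnP y.
    have -> : P = 0 by apply/eqP; rewrite -mxrank_eq0 rP y0.
    have -> : E = 0 by apply/eqP; rewrite -mxrank_eq0 rE y0.
    by rewrite mul0mx mxtrace0 mulr0.
  have yn : y%:R != 0 :> C by rewrite pnatr_eq0 -lt0n.
  apply: (mulfI yn); rewrite -tE rP natrM; ring.
move=> [Q [P' [pQ rQ sQ fP' [o ->]]]].
have [pP' rP'] := flag_proj fP'; rewrite mulnCA in fP'.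
have [M [E' [cE [rM rE] EP' fPE tE]]] := IH _ _ fP'.
have pE' := crossfree_proj cE.
have [|U [pU UQ rU [UE EU]]] := @subproj_uncoupled _ _ A Q E' (4 ^ s * y) pQ pE'.
  by rewrite rQ rE; nia.
have uUE : uncoupled U E' by split=> //; exact: ortho_sub UQ EP' o.
have [oUE _ _] := uUE.
have UP' : U *m P' = 0 by apply: ortho_sub o => //; case: pP'.
have EQ' : E' *m Q = 0.
  by apply: orthoC => //; apply: ortho_sub o => //; case: pQ.
exists M, (U + E'); split.
- by exists U, E'; split=> //; exact: scalar_on_sub sQ.
- by rewrite rM mxrank_projD // rE rU !expnS; split; lia.
- by rewrite mulmxDl !mulmxDr UQ EP' UP' EQ' addr0 add0r.
- exists (Q - U), (P' - E'); split.
  + exact: isprojB.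
  + by rewrite mxrank_projB // rQ rU; nia.
  + by apply: (scalar_on_sub pQ) sQ; [exact: isprojB | exact: subprojBl].
  + by rewrite mulnCA.
  + split; last by rewrite opprD addrACA.
    by rewrite mulmxBl !mulmxBr o UP' oUE (orthoC pE' pQ EQ') !subr0.
have [l Ql] := sQ.
have trs X : isproj X -> X *m Q = X -> \tr (X *m A) = l * (\rank X)%:R.
  move=> pX XQ; have QX := subprojC pQ pX XQ.
  have [_ iX] := pX.
  transitivity (\tr (X *m (Q *m A *m Q) *m X)).
    rewrite -[in LHS]iX -mulmxA mxtrace_mulC.
    by rewrite !mulmxA XQ -[in RHS]mulmxA QX.
  by rewrite Ql -scalemxAr -scalemxAl XQ iX mxtraceZ mxtrace_proj.
rewrite !mulmxDl !linearD /= -tE mulrDr; congr (_ + _).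
rewrite !trs //; last by case: pQ.
rewrite rQ rU !natrM; ring.
Qed.

(** In each scalar piece U, only a part T of rank at most 2 rank L is coupled to L.
    It moves to the core together with L; it is not coupled to the rest of U, on
    which A is scalar. *)
Lemma crossfree_absorb s M E L : crossfree s M E -> isproj L -> L *m E = 0 ->
  exists M', crossfree s M' (E + L) /\ (\rank M' <= \rank M + 3 ^ s * \rank L)%N.
Proof.
elim: s E L => [|s IH] E L /=.
  move=> [pM ->] pL LM; exists (M + L); split.
    by split=> //; apply: isprojD => //; exact: orthoC.
  by rewrite mxrank_projD ?mul1n //; exact: orthoC.
move=> [U [E' [pU sU cE uUE ->]]] pL LE.
have [oUE _ _] := uUE; have pE' := crossfree_proj cE.
have EU := orthoC pU pE' oUE.
have LU : L *m U = 0.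
  have : L *m (U + E') *m U = 0 by rewrite LE mul0mx.
  by rewrite -mulmxA mulmxDl EU addr0; have [_ ->] := pU.
have LE' : L *m E' = 0 by move: LE; rewrite mulmxDr LU add0r.
have [U1 [p1 U1U r1 [a1 a2]]] : exists U1, [/\ isproj U1, U1 *m U = U1,
    (\rank (U - U1)%R <= 2 * \rank L)%N & U1 *m A *m L = 0 /\ L *m A *m U1 = 0].
  have [le|gt] := leqP (2 * \rank L) (\rank U).
    have [|U1 [p1 U1U r1 a]] := @subproj_uncoupled _ _ A U L (\rank U - 2 * \rank L) pU pL.
      by rewrite subnK.
    by exists U1; split=> //; rewrite mxrank_projB // r1 subKn.
  exists 0; split; rewrite ?mul0mx ?mulmx0 ?subr0 //; first exact: isproj0.
  exact: ltnW.
pose T := U - U1; have pT : isproj T by exact: isprojB.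
have TU : T *m U = T by exact: subprojBl.
have TL : T *m L = 0.
  by apply: (ortho_sub pL pL TU) (orthoC pL pU LU); case: pL.
have TE' : T *m E' = 0 by apply: (ortho_sub pE' pE' TU) oUE; case: pE'.
have [|M' [cM' rM']] := IH E' (T + L) cE (isprojD pT pL TL).
  by rewrite mulmxDl TE' LE' addr0.
exists M'; split; last first.
  apply: leq_trans rM' _; rewrite leq_add2l mxrank_projD // expnS.
  move: (\rank T) (\rank L) r1 => t l r1; nia.
exists U1, (E' + (T + L)); split=> //.
- exact: scalar_on_sub sU.
- apply: uncoupledD.
    by apply: uncoupled_sub uUE => //; case: pE'.
  apply: uncoupledD; last first.
    split=> //; apply: (ortho_sub pL pL U1U) (orthoC pL pU LU); by case: pL.
  by apply: (scalar_on_uncoupled pU p1 pT sU U1U TU); exact: subprojB_ortho.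
by rewrite addrCA [U1 + _]addrA [U1 + T]addrC subrK addrCA addrA.
Qed.

(** The row Y is filled with the core, then with whole pieces, and at most one piece
    is split. *)
Lemma crossfree_cut s M E D : crossfree s M E -> (\rank M <= D <= \rank E)%N ->
  exists Y Z, [/\ isproj Y, \rank Y = D, crossfree s 0 Z, uncoupled Y Z & E = Y + Z].
Proof.
elim: s E D => [|s IH] E D /=.
  move=> [pM ->] /andP[l1 l2]; exists M, 0; rewrite addr0; split=> //.
  - by apply/eqP; rewrite eqn_leq l1 l2.
  - by split=> //; exact: isproj0.
  - exact: uncoupled0.
move=> [U [E' [pU sU cE uUE ->]]]; have pE' := crossfree_proj cE.
have [oUE _ _] := uUE.
rewrite mxrank_projD // => /andP[l1 l2].
have [le|gt] := leqP D (\rank E').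
  have [|Y [Z [pY rY cZ uYZ EYZ]]] := IH E' D cE; first by rewrite l1.
  have pZ := crossfree_proj cZ; have [oYZ _ _] := uYZ; have oZY := orthoC pY pZ oYZ.
  have [iY iZ] : Y *m Y = Y /\ Z *m Z = Z by case: pY; case: pZ.
  have YE : Y *m E' = Y by rewrite EYZ mulmxDr iY oYZ addr0.
  have ZE : Z *m E' = Z by rewrite EYZ mulmxDr iZ oZY add0r.
  have sub X : isproj X -> X *m E' = X -> uncoupled U X.
    by move=> pX XE; apply: uncoupled_sub uUE => //; case: pU.
  exists Y, (U + Z); split=> //.
  - by exists U, Z; split=> //; exact: sub.
  - by apply: uncoupledD => //; apply: uncoupledC => //; exact: sub.
  - by rewrite EYZ addrCA.
have [|U0 [p0 U0U r0]] := @subproj_of_rank _ _ U (D - \rank E') pU.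
  by rewrite leq_subLR addnC.
have pT := isprojB pU p0 U0U; have TU := subprojBl pU p0 U0U.
have U0E : U0 *m E' = 0 by apply: (ortho_sub pE' pE' U0U) oUE; case: pE'.
exists (U0 + E'), (U - U0); split=> //.
- exact: isprojD.
- by rewrite mxrank_projD // r0 subnK // ltnW.
- exists (U - U0), 0; rewrite addr0; split=> //; last exact: uncoupled0.
  + exact: scalar_on_sub sU.
  + exact: crossfree0.
- apply: uncoupledC => //; first exact: isprojD.
  apply: uncoupledD; last by apply: uncoupled_sub uUE => //; case: pE'.
  apply: (scalar_on_uncoupled pU pT p0 sU TU U0U).
  by apply: orthoC => //; exact: subprojB_ortho.
- by rewrite addrAC [U0 + _]addrC subrK.
Qed.

(** [k] orthonormal systems of [D] rows, pairwise uncoupled, with sum of ranges [E];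
    [S] marks those on which A need not be scalar, and there are at most [r] of
    them. *)
Definition row_system D k r E := exists (V : nat -> 'M[C]_(D, n)) (S : pred nat),
  [/\ forall i, (i < k)%N -> V i \is unitarymx,
      forall i j, (i < k)%N -> (j < k)%N -> i != j ->
        V i *m (V j)^t* = 0 /\ V i *m A *m (V j)^t* = 0,
      \sum_(i < k) (V i)^t* *m V i = E,
      forall i, (i < k)%N -> ~~ S i -> exists l, V i *m A *m (V i)^t* = l%:M
    & (\sum_(i < k) S i <= r)%N].

Lemma row_systemS D k r E Y (b : bool) : isproj Y -> \rank Y = D -> uncoupled Y E ->
  (~~ b -> scalar_on Y) -> row_system D k r E -> row_system D k.+1 (b + r) (Y + E).
Proof.
move=> pY rY [oYE YAE EAY] sY [V [S [uV oV sumV lV cS]]].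
have [W [uW WY]] := rows_of_proj pY; rewrite rY in W uW WY.
have WW := unitarymxP uW.
have WYW : W *m Y = W by rewrite -WY mulmxA WW mul1mx.
have VE i : (i < k)%N -> V i *m E = V i.
  move=> ik; rewrite -sumV mulmx_sumr (bigD1 (Ordinal ik)) //= mulmxA (unitarymxP (uV i ik)) mul1mx.
  rewrite big1 ?addr0 // => j ji; rewrite mulmxA.
  by have [|->] := oV i j ik (ltn_ord j); rewrite ?mul0mx // eq_sym.
have YW : Y *m W^t* = W^t*.
  by apply: adjmx_inj; rewrite adjmxM trmxCK; have [-> _] := pY.
have EV i : (i < k)%N -> E *m (V i)^t* = (V i)^t*.
  move=> ik; apply: adjmx_inj; rewrite adjmxM trmxCK.
  suff -> : E^t* = E by exact: VE.
  rewrite -sumV adjmx_sum; apply: eq_bigr => j _; by rewrite adjmxM trmxCK.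
pose V' i := if i is i'.+1 then V i' else W.
pose S' i := if i is i'.+1 then S i' else b.
have WVo i : (i < k)%N -> W *m (V i)^t* = 0 /\ W *m A *m (V i)^t* = 0.
  move=> ik; split.
    by rewrite -WYW -EV // mulmxA -(mulmxA W) oYE mulmx0 mul0mx.
  transitivity (W *m (Y *m A *m E) *m (V i)^t*); last by rewrite YAE mulmx0 mul0mx.
  by rewrite !mulmxA WYW -[RHS]mulmxA EV.
have VWo i : (i < k)%N -> V i *m W^t* = 0 /\ V i *m A *m W^t* = 0.
  move=> ik; split.
    by apply: adjmx_inj; rewrite adjmxM trmxCK adjmx0; case: (WVo i ik).
  transitivity (V i *m (E *m A *m Y) *m W^t*); last by rewrite EAY mulmx0 mul0mx.
  by rewrite !mulmxA VE // -[RHS]mulmxA YW.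
exists V', S'; split.
- by case=> [|i] //=; rewrite ltnS; exact: uV.
- case=> [|i] [|j] //=; rewrite ?ltnS => ik jk ij.
  + exact: WVo.
  + exact: VWo.
  + by apply: oV => //; apply: contraNneq ij => ->.
- by rewrite big_ord_recl /= WY; congr (_ + _).
- case=> [|i] /=; last by rewrite ltnS; exact: lV.
  move=> _ /sY [l Yl]; exists l.
  transitivity (W *m (Y *m A *m Y) *m W^t*).
    by rewrite !mulmxA WYW -[RHS]mulmxA YW.
  by rewrite Yl -scalemxAr -scalemxAl WYW WW scalemx1.
- by rewrite big_ord_recl /= leq_add2l.
Qed.

(** Rows are cut from the first piece as long as it has room.  A row that is not
    scalar exhausts the first piece, so there are at most as many of them as
    pieces. *)
Lemma crossfree_rows0 s E D k : (0 < D)%N -> crossfree s 0 E -> \rank E = (k * D)%N ->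
  row_system D k s E.
Proof.
move=> D0; elim: k s E => [|k IH] s E cE rE.
  have -> : E = 0 by apply/eqP; rewrite -mxrank_eq0 rE.
  by exists (fun=> 0), (fun=> false); split=> //; rewrite big_ord0.
case: s cE => [[_ E0]|s /= [U [E' [pU sU cE uUE EE]]]].
  by move: rE; rewrite E0 mxrank0; nia.
have pE' := crossfree_proj cE; have [oUE _ _] := uUE.
have rUE : (\rank U + \rank E')%N = (k.+1 * D)%N by rewrite -mxrank_projD // -EE.
have [le|gt] := leqP D (\rank U).
  have [Y [pY YU rY]] := subproj_of_rank pU le.
  have pT := isprojB pU pY YU; have TU := subprojBl pU pY YU.
  have uYE : uncoupled Y E' by apply: uncoupled_sub uUE => //; case: pE'.
  have uTE : uncoupled (U - Y) E' by apply: uncoupled_sub uUE => //; case: pE'.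
  have -> : E = Y + ((U - Y) + E') by rewrite EE addrA [Y + _]addrC subrK.
  apply: (@row_systemS _ _ _ _ _ false) => //.
  - apply: uncoupledD => //; apply: (scalar_on_uncoupled pU pY pT sU YU TU).
    exact: subprojB_ortho.
  - by move=> _; exact: scalar_on_sub sU.
  - apply: IH; last first.
      by case: uTE => oTE _ _; rewrite mxrank_projD // mxrank_projB // rY; lia.
    by exists (U - Y), E'; split=> //; exact: scalar_on_sub sU.
have [|Y [Z [pY rY cZ uYZ EYZ]]] := @crossfree_cut s 0 E' (D - \rank U) cE.
  by rewrite mxrank0; lia.
have pZ := crossfree_proj cZ; have [oYZ _ _] := uYZ; have oZY := orthoC pY pZ oYZ.
have [iY iZ] : Y *m Y = Y /\ Z *m Z = Z by case: pY; case: pZ.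
have YE : Y *m E' = Y by rewrite EYZ mulmxDr iY oYZ addr0.
have ZE : Z *m E' = Z by rewrite EYZ mulmxDr iZ oZY add0r.
have uUY : uncoupled U Y by apply: uncoupled_sub uUE => //; case: pU.
have uUZ : uncoupled U Z by apply: uncoupled_sub uUE => //; case: pU.
have [oUY _ _] := uUY; have [oUZ _ _] := uUZ.
have -> : E = (U + Y) + Z by rewrite EE EYZ addrA.
have pUY := isprojD pU pY oUY.
have rUY : \rank (U + Y)%R = D by rewrite mxrank_projD // rY subnKC // ltnW.
apply: (@row_systemS _ _ _ _ _ true) => //.
  apply: uncoupledC => //; apply: uncoupledD; exact: uncoupledC.
apply: IH => //; have := mxrank_projD pY pZ oYZ; rewrite -EYZ rY; lia.
Qed.

Lemma crossfree_rows s M E D k : (0 < D)%N -> crossfree s M E -> (\rank M <= D)%N ->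
  \rank E = (k.+1 * D)%N -> row_system D k.+1 s.+1 E.
Proof.
move=> D0 cE rM rE.
have [|Y [Z [pY rY cZ uYZ EYZ]]] := @crossfree_cut s M E D cE; first by rewrite rM rE; lia.
rewrite EYZ; apply: (@row_systemS _ _ _ _ _ true) => //; apply: crossfree_rows0 => //.
have pZ := crossfree_proj cZ; have [oYZ _ _] := uYZ.
move: rE; rewrite EYZ mxrank_projD // rY; lia.
Qed.

End Packages.

(** * Bounds on the operator norm *)

Section Norms.
Variable R : realType.
Local Notation C := R[i].
Local Notation normc := ComplexField.Normc.normc.
Local Notation "x %:C" := (real_complex R x) (at level 1, format "x %:C").

Lemma normr_normc (z : C) : (normc z)%:C = `|z|.
Proof. by []. Qed.

Lemma normc_ge0 (z : C) : 0 <= normc z.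
Proof. by case: z => a b /=; exact: sqrtr_ge0. Qed.

Lemma normc_real (x : R) : normc x%:C = `|x|.
Proof. by rewrite /= expr0n addr0 sqrtr_sqr. Qed.

Definition nsq n (x : 'cV[C]_n) : R := \sum_(i < n) normc (x i ord0) ^+ 2.

Lemma nsq_ge0 n (x : 'cV[C]_n) : 0 <= nsq x.
Proof. by apply: sumr_ge0 => i _; exact: sqr_ge0. Qed.

Lemma nsqE n (x : 'cV[C]_n) : (nsq x)%:C = (x^t* *m x) 0 0.
Proof.
rewrite rmorph_sum mxE; apply: eq_bigr => i _.
by rewrite rmorphXn /= normr_normc !mxE normCK mulrC.
Qed.

Lemma nsq_eq0 n (x : 'cV[C]_n) : nsq x = 0 -> x = 0.
Proof.
move/eqP; rewrite psumr_eq0; last by move=> i _; exact: sqr_ge0.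
move=> /allP x0; apply/matrixP => i j; rewrite ord1 mxE.
have := x0 i (mem_index_enum _); rewrite sqrf_eq0 => /eqP.
exact: ComplexField.Normc.eq0_normc.
Qed.

Lemma nsq0 n : nsq (0 : 'cV[C]_n) = 0.
Proof. by apply: big1 => i _; rewrite mxE ComplexField.Normc.normc0 expr0n. Qed.

Lemma nsqZ n (a : C) (x : 'cV[C]_n) : nsq (a *: x) = normc a ^+ 2 * nsq x.
Proof.
by rewrite /nsq mulr_sumr; apply: eq_bigr => i _; rewrite mxE ComplexField.Normc.normcM exprMn.
Qed.

(** The triangle inequality in squared form; the best [t] is the ratio of the two
    norms. *)
Lemma nsqD_le n (t : R) (x y : 'cV[C]_n) : 0 < t ->
  nsq (x + y) <= (1 + t) * nsq x + (1 + t^-1) * nsq y.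
Proof.
move=> t0; rewrite /nsq !mulr_sumr -big_split; apply: ler_sum => i _ /=.
rewrite mxE; set u := x i ord0; set v := y i ord0.
have uv := le_normcD u v; have := normc_ge0 (u + v).
have := normc_ge0 u; have := normc_ge0 v.
move: (normc u) (normc v) (normc (u + v)) uv => a b c cab b0 a0 c0.
apply: le_trans (_ : (a + b) ^+ 2 <= _); first by rewrite ler_pXn2r ?nnegrE ?addr_ge0.
rewrite -subr_ge0.
have -> : (1 + t) * a ^+ 2 + (1 + t^-1) * b ^+ 2 - (a + b) ^+ 2 = t^-1 * (t * a - b) ^+ 2.
  by field; rewrite gt_eqF.
by rewrite mulr_ge0 ?sqr_ge0 // invr_ge0 ltW.
Qed.

(** A bound on the operator norm in squared form, free of square roots and suprema,
    and meaningful for rectangular matrices. *)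
Definition opb m n (c : R) (A : 'M[C]_(m, n)) : Prop :=
  forall x, nsq (A *m x) <= c ^+ 2 * nsq x.

Lemma opb0 m n (c : R) : opb c (0 : 'M[C]_(m, n)).
Proof. by move=> x; rewrite mul0mx nsq0 mulr_ge0 ?sqr_ge0 ?nsq_ge0. Qed.

Lemma opb_le m n (c d : R) (A : 'M[C]_(m, n)) : 0 <= c <= d -> opb c A -> opb d A.
Proof.
move=> /andP[c0 cd] cA x; apply: le_trans (cA x) _.
by rewrite ler_wpM2r ?nsq_ge0 // ler_pXn2r ?nnegrE // (le_trans c0).
Qed.

Lemma opbM m n p (c d : R) (A : 'M[C]_(m, n)) (B : 'M[C]_(n, p)) :
  opb c A -> opb d B -> opb (c * d) (A *m B).
Proof.
move=> cA dB x; rewrite -mulmxA; apply: le_trans (cA _) _.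
by rewrite exprMn -[leRHS]mulrA; apply: ler_wpM2l; [exact: sqr_ge0 | exact: dB].
Qed.

Lemma opbZ m n (a : C) (c : R) (A : 'M[C]_(m, n)) : opb c A -> opb (normc a * c) (a *: A).
Proof.
move=> cA x; rewrite -scalemxAl nsqZ exprMn -[leRHS]mulrA; apply: ler_wpM2l; [exact: sqr_ge0 | exact: cA].
Qed.

Lemma opbN m n (c : R) (A : 'M[C]_(m, n)) : opb c A -> opb c (- A).
Proof.
move=> /(opbZ (-1)); rewrite scaleN1r.
by rewrite normcN ComplexField.Normc.normc1 mul1r.
Qed.

Lemma opb_small0 m n (A : 'M[C]_(m, n)) : opb 0 A -> A = 0.
Proof.
move=> A0; apply/matrixP => i j; rewrite mxE.
have := A0 (delta_mx j ord0); rewrite expr0n mul0r => le0.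
have : A *m delta_mx j ord0 = 0 :> 'cV_m.
  by apply: nsq_eq0; apply/le_anti; rewrite le0 nsq_ge0.
by rewrite -colE => /colP/(_ i); rewrite !mxE.
Qed.

Lemma opbD m n (c d : R) (A B : 'M[C]_(m, n)) : 0 <= c -> 0 <= d ->
  opb c A -> opb d B -> opb (c + d) (A + B).
Proof.
move=> c0 d0 cA dB.
have [c00|cn] := eqVneq c 0; first by move: cA; rewrite c00 => /opb_small0 ->; rewrite !add0r.
have [d00|dn] := eqVneq d 0; first by move: dB; rewrite d00 => /opb_small0 ->; rewrite !addr0.
have cp : 0 < c by rewrite lt_def cn.
have dp : 0 < d by rewrite lt_def dn.
move=> x; rewrite mulmxDl; apply: le_trans (@nsqD_le _ (d / c) _ _ _) _.
  by rewrite divr_gt0.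
have -> : (c + d) ^+ 2 * nsq x =
  (1 + d / c) * (c ^+ 2 * nsq x) + (1 + (d / c)^-1) * (d ^+ 2 * nsq x).
  by field; rewrite cn dn.
by apply: lerD; rewrite ler_wpM2l // addr_ge0 ?invr_ge0 // divr_ge0.
Qed.

Lemma opbB m n (c d : R) (A B : 'M[C]_(m, n)) : 0 <= c -> 0 <= d ->
  opb c A -> opb d B -> opb (c + d) (A - B).
Proof. by move=> c0 d0 cA /opbN; exact: opbD. Qed.

Lemma opb_sum m n (I : Type) (r : seq I) (c : I -> R) (F : I -> 'M[C]_(m, n)) :
  (forall i, 0 <= c i) -> (forall i, opb (c i) (F i)) ->
  opb (\sum_(i <- r) c i) (\sum_(i <- r) F i).
Proof.
move=> c0 cF; elim: r => [|i r IH]; first by rewrite !big_nil; exact: opb0.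
by rewrite !big_cons; apply: opbD => //; exact: sumr_ge0.
Qed.

Lemma opb_scalar n (a : C) : opb (normc a) (a%:M : 'M[C]_n).
Proof. by move=> x; rewrite mul_scalar_mx nsqZ. Qed.

Lemma nsq_adj_rows k n (W : 'M[C]_(k, n)) x : W \is unitarymx -> nsq (W^t* *m x) = nsq x.
Proof.
move=> /unitarymxP uW; apply: complexI; rewrite !nsqE adjmxM trmxCK.
by rewrite mulmxA -(mulmxA _ W) uW mulmx1.
Qed.

Lemma nsq_orthoD n (x y : 'cV[C]_n) : x^t* *m y = 0 -> nsq (x + y) = nsq x + nsq y.
Proof.
move=> xy; apply: complexI; rewrite rmorphD /= !nsqE.
have yx : y^t* *m x = 0 by apply: adjmx_inj; rewrite adjmxM trmxCK xy adjmx0.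
by rewrite adjmxD mulmxDl !mulmxDr xy yx addr0 add0r mxE.
Qed.

Lemma nsq_proj n (P : 'M[C]_n) x : isproj P -> nsq (P *m x) + nsq (x - P *m x) = nsq x.
Proof.
move=> [aP iP]; rewrite -nsq_orthoD; first by rewrite addrC subrK.
by rewrite adjmxM aP mulmxBr !mulmxA -(mulmxA _ P P) iP subrr.
Qed.

Lemma nsq_proj_le n (P : 'M[C]_n) x : isproj P -> nsq (P *m x) <= nsq x.
Proof. by move=> pP; rewrite -(nsq_proj x pP) lerDl nsq_ge0. Qed.

Lemma opb_proj n (P : 'M[C]_n) : isproj P -> opb 1 P.
Proof. by move=> pP x; rewrite expr1n mul1r nsq_proj_le. Qed.

Lemma opb_rows k n (W : 'M[C]_(k, n)) : W \is unitarymx -> opb 1 W.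
Proof.
move=> uW x; rewrite expr1n mul1r -(nsq_adj_rows _ uW) mulmxA.
exact/nsq_proj_le/isproj_rows.
Qed.

Lemma opb_adj_rows k n (W : 'M[C]_(k, n)) : W \is unitarymx -> opb 1 (W^t*).
Proof. by move=> uW x; rewrite expr1n mul1r nsq_adj_rows. Qed.

Lemma normc_mxtrace D (c : R) (G : 'M[C]_D) : 0 <= c -> opb c G ->
  normc (\tr G) <= D%:R * c.
Proof.
move=> c0 cG; rewrite /mxtrace mulr_natl -[D in leRHS]card_ord -sumr_const.
elim/big_ind2: _ => [|x1 x2 y1 y2 h1 h2|i _]; first by rewrite ComplexField.Normc.normc0.
  exact: le_trans (le_normcD _ _) (lerD h1 h2).
rewrite -(@ler_pXn2r _ 2) ?nnegrE ?normc_ge0 //.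
have := cG (delta_mx i ord0); rewrite -colE.
have -> : nsq (delta_mx i ord0 : 'cV[C]_D) = 1.
  rewrite /nsq (bigD1 i) //= mxE !eqxx ComplexField.Normc.normc1 expr1n big1 ?addr0 // => j ji.
  by rewrite mxE (negPf ji) ComplexField.Normc.normc0 expr0n.
rewrite mulr1; apply: le_trans.
rewrite /nsq (bigD1 i) //= mxE lerDl; apply: sumr_ge0 => j _; exact: sqr_ge0.
Qed.

Lemma nsq_orthosum n K (P : nat -> 'M[C]_n) (y : nat -> 'cV[C]_n) :
  (forall i, (i < K)%N -> isproj (P i)) ->
  (forall i j, (i < K)%N -> (j < K)%N -> i != j -> P i *m P j = 0) ->
  nsq (\sum_(i < K) P i *m y i) = \sum_(i < K) nsq (P i *m y i).
Proof.
elim: K => [|K IH] pP oP; first by rewrite !big_ord0 nsq0.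
rewrite !big_ord_recr /= -IH; last 2 first.
- by move=> i iK; apply: pP; exact: ltnW.
- by move=> i j iK jK; apply: oP; exact: ltnW.
apply: nsq_orthoD; rewrite adjmx_sum mulmx_suml big1 // => i _.
have [aP _] : isproj (P i) by apply: pP; rewrite ltnW // ltnS.
rewrite adjmxM aP mulmxA -(mulmxA _ (P i)) oP ?mulmx0 ?mul0mx //.
- by rewrite ltnW // ltnS.
- by rewrite neq_ltn ltn_ord.
Qed.

Lemma isproj_sum n K (P : nat -> 'M[C]_n) :
  (forall i, (i < K)%N -> isproj (P i)) ->
  (forall i j, (i < K)%N -> (j < K)%N -> i != j -> P i *m P j = 0) ->
  isproj (\sum_(i < K) P i).
Proof.
elim: K => [|K IH] pP oP; first by rewrite big_ord0; exact: isproj0.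
rewrite big_ord_recr /=; apply: isprojD; last 2 first.
- exact: pP.
- rewrite mulmx_suml big1 // => i _; apply: oP => //; first by rewrite ltnW // ltnS.
  by rewrite neq_ltn ltn_ord.
apply: IH => [i iK|i j iK jK]; [apply: pP | apply: oP]; exact: ltnW.
Qed.

(** Pythagoras, on both sides. *)
Lemma opb_blockdiag n K (c : R) (P T : nat -> 'M[C]_n) :
  (forall i, (i < K)%N -> isproj (P i)) ->
  (forall i j, (i < K)%N -> (j < K)%N -> i != j -> P i *m P j = 0) ->
  (forall i, (i < K)%N -> P i *m T i *m P i = T i) ->
  (forall i, (i < K)%N -> opb c (T i)) ->
  opb c (\sum_(i < K) T i).
Proof.
move=> pP oP PT cT x; rewrite mulmx_suml.
have -> : \sum_(i < K) T i *m x = \sum_(i < K) P i *m (T i *m x).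
  apply: eq_bigr => i _; rewrite mulmxA -[in LHS]PT // -[in RHS]PT //.
  by rewrite !mulmxA; have [_ ->] := pP i (ltn_ord i).
rewrite (@nsq_orthosum _ _ _ (fun i => T i *m x)) //.
have pS := isproj_sum pP oP.
apply: le_trans (_ : c ^+ 2 * nsq ((\sum_(i < K) P i) *m x) <= _); last first.
  by rewrite ler_wpM2l ?sqr_ge0 // nsq_proj_le.
rewrite mulmx_suml (@nsq_orthosum _ _ _ (fun i => x)) // mulr_sumr.
apply: ler_sum => i _; apply: le_trans (nsq_proj_le _ (pP i (ltn_ord i))) _.
rewrite -[in leLHS]PT // -mulmxA.
have pi := pP i (ltn_ord i).
apply: le_trans (_ : nsq (T i *m (P i *m x)) <= _); last exact: cT.
by rewrite -mulmxA nsq_proj_le.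
Qed.

Section OpNorm.
Variable n : nat.
Implicit Types A B : 'M[C]_n.

Lemma l2norm_sq (x : 'cV[C]_n) : l2norm x ^+ 2 = nsq x.
Proof. by rewrite sqr_sqrtr ?nsq_ge0. Qed.

Lemma l2norm_ge0 (x : 'cV[C]_n) : 0 <= l2norm x.
Proof. exact: sqrtr_ge0. Qed.

(** The sum of the moduli of the entries is a crude bound; it only serves to show
    that the supremum defining [opnorm] is finite. *)
Lemma opb_exists A : exists2 c : R, 0 <= c & opb c A.
Proof.
exists (\sum_(ij : 'I_n * 'I_n) normc (A ij.1 ij.2)).
  by apply: sumr_ge0 => i _; exact: normc_ge0.
rewrite [A in opb _ A]matrix_sum_delta pair_bigA /=.
apply: opb_sum => [i|i]; first exact: normc_ge0.
rewrite -[normc _]mulr1; apply: opbZ => x; rewrite expr1n mul1r.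
rewrite /nsq (bigD1 i.1) //= big1 ?addr0; last first.
  move=> j ji; rewrite mxE big1 ?ComplexField.Normc.normc0 ?expr0n // => k _.
  by rewrite mxE (negPf ji) mul0r.
rewrite mxE (bigD1 i.2) //= big1 ?addr0; last first.
  by move=> k ki; rewrite mxE (negPf ki) andbF mul0r.
rewrite mxE !eqxx mul1r (bigD1 i.2) //= lerDl; apply: sumr_ge0 => j _; exact: sqr_ge0.
Qed.

Lemma opnorm_le A (c : R) : 0 <= c -> opb c A -> opnorm A <= c.
Proof.
move=> c0 cA; apply: ge_sup.
  exists (l2norm (A *m 0)), 0 => //=.
  by rewrite -(@ler_pXn2r _ 2) ?nnegrE ?l2norm_ge0 // l2norm_sq nsq0 expr1n.
move=> _ [x /= x1 <-]; rewrite -(@ler_pXn2r _ 2) ?nnegrE ?l2norm_ge0 // l2norm_sq.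
apply: le_trans (cA x) _; rewrite ler_piMr ?sqr_ge0 // -l2norm_sq.
by rewrite exprn_ile1 ?l2norm_ge0.
Qed.

Lemma opnorm_has_sup A :
  has_sup [set l2norm (A *m x) | x in [set x : 'cV[C]_n | l2norm x <= 1]]%classic.
Proof.
have [c c0 cA] := opb_exists A; split.
  exists (l2norm (A *m 0)), 0 => //=.
  by rewrite -(@ler_pXn2r _ 2) ?nnegrE ?l2norm_ge0 // l2norm_sq nsq0 expr1n.
exists c => _ [x /= x1 <-]; rewrite -(@ler_pXn2r _ 2) ?nnegrE ?l2norm_ge0 // l2norm_sq.
apply: le_trans (cA x) _; rewrite ler_piMr ?sqr_ge0 // -l2norm_sq.
by rewrite exprn_ile1 ?l2norm_ge0.
Qed.

Lemma opnorm_ge A x : l2norm x <= 1 -> l2norm (A *m x) <= opnorm A.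
Proof.
move=> x1; have [_ ub] := opnorm_has_sup A.
by apply: ub_le_sup => //; exists x.
Qed.

Lemma opnorm_ge0 A : 0 <= opnorm A.
Proof.
apply: le_trans (l2norm_ge0 (A *m 0)) (opnorm_ge _ _).
by rewrite -(@ler_pXn2r _ 2) ?nnegrE ?l2norm_ge0 // l2norm_sq nsq0 expr1n.
Qed.

Lemma opb_opnorm A : opb (opnorm A) A.
Proof.
move=> x; have [x0|x0] := eqVneq (nsq x) 0.
  by rewrite (nsq_eq0 x0) mulmx0 !nsq0 mulr0.
have xp : 0 < nsq x by rewrite lt_def x0 nsq_ge0.
have lp : 0 < l2norm x by rewrite sqrtr_gt0.
have nV : normc (l2norm x)^-1%:C ^+ 2 = (nsq x)^-1.
  by rewrite normc_real -normrX ger0_norm ?sqr_ge0 // exprVn l2norm_sq.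
have := @opnorm_ge A ((l2norm x)^-1%:C *: x).
rewrite -(@ler_pXn2r _ 2) ?nnegrE ?l2norm_ge0 // l2norm_sq nsqZ nV mulVf // expr1n => /(_ (lexx _)).
rewrite -(@ler_pXn2r _ 2) ?nnegrE ?l2norm_ge0 ?opnorm_ge0 // l2norm_sq -scalemxAr nsqZ nV.
by rewrite ler_pdivrMl // mulrC.
Qed.

End OpNorm.
End Norms.

(** * Mixing the rows of a package *)

(** Sylvester's doubling construction. *)
Lemma hadamard_exists (F : comUnitRingType) k m : m = (2 ^ k)%N ->
  exists H : 'M[F]_m, (forall i j, H i j = 1 \/ H i j = -1) /\ H *m H^T = (m%:R)%:M.
Proof.
elim: k m => [|k IH] m ->.
  exists 1%:M; split; last by rewrite trmx1 mulmx1.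
  by move=> i j; rewrite !ord1 mxE; left.
have [H [Hpm HH]] := IH _ erefl.
rewrite expnS mul2n -addnn; exists (block_mx H H H (- H)); split.
  move=> i j; rewrite mxE; case: splitP => i' _; rewrite mxE; case: splitP => j' _ //.
  by rewrite mxE; case: (Hpm i' j') => ->; [right | left; rewrite opprK].
rewrite tr_block_mx mulmx_block linearN /= !mulmxN !mulNmx opprK HH subrr.
by rewrite natrD raddfD /= !scalar_mx_block add_block_mx !addr0.
Qed.

Section Blocks.
Variables (R : realType) (n : nat) (A : 'M[R[i]]_n).
Local Notation C := R[i].
Local Notation normc := ComplexField.Normc.normc.
Implicit Types (P Q E : 'M[C]_n) (gs : seq 'M[C]_n).

Definition orthogonal_family P gs := [/\ forall x, x \in gs -> isproj x,
  pairwise (fun x y => x *m y == 0) gs & \sum_(x <- gs) x = P].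

Lemma orthogonal_family_sub P gs x : orthogonal_family P gs -> x \in gs -> x *m P = x.
Proof.
move=> [pgs ogs <-]; elim: gs pgs ogs => // y gs IH pgs /= /andP[/allP oy ogs].
rewrite inE big_cons mulmxDr => /orP[/eqP ->|xgs].
  have [_ ->] : isproj y by apply: pgs; rewrite mem_head.
  rewrite mulmx_sumr big_seq big1 ?addr0 // => z zgs; exact/eqP/oy.
have pgs' z : z \in gs -> isproj z by move=> zgs; apply: pgs; rewrite inE zgs orbT.
rewrite IH // (@orthoC _ _ y x) ?add0r //; [|exact: pgs' | exact/eqP/oy].
by apply: pgs; rewrite mem_head.
Qed.

Lemma orthogonal_family_proj P gs : orthogonal_family P gs -> isproj P.
Proof.
move=> [pgs ogs <-]; elim: gs pgs ogs => [|y gs IH] pgs /=.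
  by rewrite big_nil => _; exact: isproj0.
move=> /andP[/allP oy ogs]; rewrite big_cons; apply: isprojD.
- by apply: pgs; rewrite mem_head.
- by apply: IH => // z zgs; apply: pgs; rewrite inE zgs orbT.
- rewrite mulmx_sumr big_seq big1 // => z zgs; exact/eqP/oy.
Qed.

Lemma orthogonal_family_cat P Q gs hs : P *m Q = 0 ->
  orthogonal_family P gs -> orthogonal_family Q hs -> orthogonal_family (P + Q) (gs ++ hs).
Proof.
move=> o oP oQ; have pQ := orthogonal_family_proj oQ.
have [p1 o1 s1] := oP; have [p2 o2 s2] := oQ; split.
- by move=> x; rewrite mem_cat => /orP[/p1|/p2].
- rewrite pairwise_cat o1 o2 !andbT; apply/allrelP => x y xg yh; apply/eqP.
  exact: (ortho_sub pQ (p2 _ yh) (orthogonal_family_sub oP xg) (orthogonal_family_sub oQ yh) o).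
- by rewrite big_cat /= s1 s2.
Qed.

(** The bound on the rank makes the induction on the rank progress. *)
Definition small_blocks (e : R) (N : nat) gs := forall x, x \in gs ->
  [/\ \tr (x *m A) = 0, opb e (x *m A *m x) & (2 * \rank x <= N)%N].

Hypothesis A1 : opb 1 A.

(** Let W_i be the sum of the H_ik V_k / 2 ^ h for a Hadamard matrix H.  The rows are
    uncoupled and the entries of H are signs, so that every W_i A W_i^* is the average
    of the V_k A V_k^*.  Its trace is that of E A divided by 4 ^ h, hence 0.  In the
    sum of the V_k A V_k^*, the at most r nonscalar terms have norm at most 1 each,
    and the scalar terms add up to a scalar of modulus at most r, because the total
    trace is 0. *)
Lemma row_system_mix h D r E : (0 < h)%N -> (0 < D)%N ->
  \tr (E *m A) = 0 -> \rank E = (4 ^ h * D)%N -> row_system A D (4 ^ h) r E ->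
  exists gs, [/\ size gs = (4 ^ h)%N, orthogonal_family E gs
    & small_blocks ((2 * r)%:R / (4 ^ h)%:R) (4 ^ h * D) gs].
Proof.
move=> h0 D0 tE rE [V [S [uV oV sumV lV cS]]].
have [m mE] : exists m, (4 ^ h)%N = m by exists (4 ^ h)%N.
rewrite mE in rE oV uV sumV lV cS *.
have [H [Hpm HH]] := @hadamard_exists C (2 * h) m (etrans (esym mE) (esym (expnM 2 2 h))).
have m0 : (0 < m)%N by rewrite -mE expn_gt0.
have mn : m%:R != 0 :> C by rewrite pnatr_eq0 -lt0n.
(* The square root of 1 / m is rational because m is a power of 4. *)
pose w : C := ((2 ^ h)%:R)^-1.
have wC : w^* = w by rewrite /w fmorphV /= conjC_nat.
have ww : w * w = m%:R^-1.
  by rewrite /w -invfM -natrM -expnMn -mE.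
have HC i j : (H i j)^* = H i j by case: (Hpm i j) => ->; rewrite ?rmorphN rmorph1.
pose W (i : 'I_m) : 'M[C]_(D, n) := \sum_(k < m) (w * H i k) *: V k.
have HHe i j : \sum_k H i k * H j k = m%:R *+ (i == j).
  by move/matrixP/(_ i j): HH; rewrite !mxE => <-; apply: eq_bigr => k _; rewrite mxE.
have HtH i j : \sum_k H k i * H k j = m%:R *+ (i == j).
  have /mulmx1C/matrixP/(_ i j) : (m%:R^-1 *: H) *m H^T = 1%:M.
    by rewrite -scalemxAl HH -scalemx1 scalerA mulVf // scale1r.
  rewrite -scalemxAr !mxE => /(congr1 (fun z => m%:R * z)).
  rewrite mulrA mulfV // mul1r mulr_natr => <-.
  by apply: eq_bigr => k _; rewrite mxE.
have WXW (X : 'M[C]_n) i j :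
    (forall k l : 'I_m, k != l -> V k *m X *m (V l)^t* = 0) ->
    W i *m X *m (W j)^t* = \sum_(k < m) (m%:R^-1 * (H i k * H j k)) *: (V k *m X *m (V k)^t*).
  move=> oX; rewrite /W !mulmx_suml; apply: eq_bigr => k _.
  rewrite adjmx_sum mulmx_sumr (bigD1 k) //= big1 ?addr0 => [|l lk].
    by rewrite adjmxZ -!scalemxAl -scalemxAr scalerA rmorphM /= wC HC mulrACA ww.
  by rewrite adjmxZ -!scalemxAl -scalemxAr oX ?scaler0 // eq_sym.
have VV (k : 'I_m) : V k *m (V k)^t* = 1%:M by apply/unitarymxP/uV.
have oVV (k l : 'I_m) : k != l -> V k *m (V l)^t* = 0.
  by move=> kl; case: (oV k l (ltn_ord k) (ltn_ord l) kl).
have WW i j : W i *m (W j)^t* = (i == j)%:R%:M.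
  have := @WXW 1%:M i j; rewrite mulmx1 => ->; last by move=> k l; rewrite mulmx1; exact: oVV.
  under eq_bigr => k _ do rewrite mulmx1 VV.
  by rewrite -scaler_suml -mulr_sumr HHe scalemx1 mulrnAr mulVf.
have uW i : W i \is unitarymx by apply/unitarymxP; rewrite WW eqxx.
pose T := \sum_(k < m) V k *m A *m (V k)^t*.
have WAW i : W i *m A *m (W i)^t* = m%:R^-1 *: T.
  rewrite WXW; last by move=> k l kl; case: (oV k l (ltn_ord k) (ltn_ord l) kl).
  rewrite /T scaler_sumr; apply: eq_bigr => k _.
  suff -> : H i k * H i k = 1 by rewrite mulr1.
  by case: (Hpm i k) => ->; rewrite ?mulrNN mulr1.
have trT : \tr T = 0.
  rewrite -[RHS]tE -sumV mulmx_suml !linear_sum; apply: eq_bigr => k _ /=.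
  by rewrite mxtrace_mulC mulmxA.
have cVAV (k : 'I_m) : opb 1 (V k *m A *m (V k)^t*).
  rewrite -[1](mulr1 1) -{1}[1](mulr1 1); apply: opbM; last exact/opb_adj_rows/uV.
  by apply: opbM => //; exact/opb_rows/uV.
have cT : opb (2 * r)%:R T.
  pose G := \sum_(k < m) if S k then V k *m A *m (V k)^t* else 0.
  have cG : opb r%:R G.
    apply: opb_le (_ : opb (\sum_(k < m) (S k)%:R) G).
      by rewrite sumr_ge0 //= -natr_sum ler_nat.
    by apply: opb_sum => // k; case: (S k) => //; exact: opb0.
  have [l Tl] : exists l : C, T = G + l%:M.
    have [l lE] : exists l : 'I_m -> C, forall k : 'I_m, ~~ S k -> V k *m A *m (V k)^t* = (l k)%:M.
      apply: (fin_all_exists (P := fun k l => ~~ S (nat_of_ord k) -> V k *m A *m (V k)^t* = l%:M)) => k.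
      case: (boolP (S k)) => [_|/(lV _ (ltn_ord k)) [l lE]]; first by exists 0.
      by exists l.
    exists (\sum_(k < m) if S k then 0 else l k).
    rewrite (raddf_sum (@scalar_mx C D)) -big_split; apply: eq_bigr => k _ /=.
    by case: ifPn => [_|/lE]; rewrite ?raddf0 ?addr0 ?add0r.
  have Dn : 0 < D%:R :> R by rewrite ltr0n.
  have lr : normc l <= r%:R.
    have : \tr G = - (D%:R * l).
      apply/eqP; rewrite -subr_eq0 opprK mulr_natl -mxtrace_scalar -linearD /= -Tl.
      by rewrite trT.
    move=> trG; have := normc_mxtrace (ler0n R r) cG.
    rewrite trG normcN ComplexField.Normc.normcM -[D%:R](rmorph_nat (real_complex R)).
    by rewrite normc_real normr_nat ler_pM2l.
  rewrite Tl mul2n -addnn natrD; apply: opbD; rewrite ?ler0n //.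
  by apply: (opb_le _ (@opb_scalar R D l)); rewrite normc_ge0.
exists [seq (W i)^t* *m W i | i <- enum 'I_m]; split.
- by rewrite size_map size_enum_ord.
- split.
  + by move=> x /mapP[i _ ->]; exact: isproj_rows.
  + rewrite pairwise_map; apply: sub_pairwise (_ : pairwise [rel x y | x != y] (enum 'I_m)).
      move=> i j /= ij; apply/eqP.
      by rewrite mulmxA -(mulmxA _ (W i)) WW (negPf ij) mulr0n raddf0 mulmx0 mul0mx.
    by rewrite -uniq_pairwise enum_uniq.
  + rewrite big_map big_enum /= -sumV.
    under eq_bigr => i _.
      rewrite /W adjmx_sum mulmx_suml.
      under eq_bigr => k _.
        rewrite mulmx_sumr.
        under eq_bigr => l _ do
          rewrite adjmxZ -scalemxAl -scalemxAr scalerA rmorphM /= wC HC mulrACA ww.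
        over.
      over.
    rewrite exchange_big; apply: eq_bigr => k _ /=.
    rewrite exchange_big (bigD1 k) //= [X in _ + X]big1 ?addr0 => [|l lk].
      by rewrite -scaler_suml -mulr_sumr HtH eqxx mulr1n mulVf // scale1r.
    by rewrite -scaler_suml -mulr_sumr HtH eq_sym (negPf lk) mulr0 scale0r.
move=> x /mapP[i _ ->]; split.
- by rewrite -mulmxA mxtrace_mulC WAW linearZ /= trT mulr0.
- rewrite -!mulmxA (mulmxA (W i) A) (mulmxA _ ((W i)^t*)) WAW.
  rewrite -[X in opb X]mul1r; apply: opbM; first exact: opb_adj_rows.
  rewrite -[X in opb X]mulr1; apply: opbM; last exact: opb_rows.
  rewrite mulrC; have -> : m%:R^-1 = normc (m%:R^-1 : C).
    by rewrite -[m%:R in RHS](rmorph_nat (real_complex R)) -fmorphV normc_real ger0_norm ?invr_ge0.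
  exact: opbZ.
- rewrite mxrank_rows // leq_mul2r; apply/orP; right.
  by rewrite -mE (@leq_trans (4 ^ 1)) // leq_exp2l.
Qed.

Lemma crossfree_blocks s M E h D : (0 < h)%N -> (\rank M <= D)%N ->
  crossfree A s M E -> \rank E = (4 ^ h * D)%N -> \tr (E *m A) = 0 ->
  exists gs, [/\ size gs = (4 ^ h)%N, orthogonal_family E gs
    & small_blocks ((2 * s.+1)%:R / (4 ^ h)%:R) (4 ^ h * D) gs].
Proof.
move=> h0 rM cE rE tE; have [D0|D0] := posnP D.
  exists (nseq (4 ^ h) 0); rewrite size_nseq.
  have -> : E = 0 by apply/eqP; rewrite -mxrank_eq0 rE D0 muln0.
  split=> //; first split.
  - by move=> x /nseqP[-> _]; exact: isproj0.
  - elim: (4 ^ h)%N => //= k ->; rewrite andbT; apply/allP => x /nseqP[-> _].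
    by rewrite mulmx0.
  - by rewrite big1_seq // => x /= /nseqP[-> _].
  move=> x /nseqP[-> _]; rewrite !mul0mx mxtrace0 mxrank0 muln0; split=> //.
  exact: opb0.
apply: row_system_mix => //; have [k kE] : exists k, (4 ^ h = k.+1)%N.
  by exists (4 ^ h).-1; rewrite prednK // expn_gt0.
by rewrite kE in rE *; exact: (crossfree_rows D0 cE).
Qed.

End Blocks.

(** * Decomposition into small blocks *)

Section Decomposition.
Variables (R : realType) (n : nat) (A : 'M[R[i]]_n).
Local Notation C := R[i].
Implicit Types (P Q E L : 'M[C]_n) (gs : seq 'M[C]_n).
Hypothesis A1 : opb 1 A.

Lemma small_blocks_le e N N' gs : (N <= N')%N -> small_blocks A e N gs -> small_blocks A e N' gs.
Proof. by move=> le sgs x /sgs[? ? r]; split=> //; exact: leq_trans le. Qed.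

Lemma small_blocks_cat e N gs hs : small_blocks A e N gs -> small_blocks A e N hs ->
  small_blocks A e N (gs ++ hs).
Proof. by move=> sg sh x; rewrite mem_cat => /orP[/sg|/sh]. Qed.

Lemma orthogonal_family0 : orthogonal_family (0 : 'M[C]_n) [::].
Proof. by split=> //; rewrite big_nil. Qed.

(** Extract p packages in a row and mix each of them; (7/8) ^ p of the rank remains. *)
Lemma flag_blocks s h p N P : (0 < h)%N -> (4 ^ h * 3 ^ s <= 4 ^ s)%N ->
  flag A s (8 ^ p * N)%N P -> \tr (P *m A) = 0 ->
  exists gs L, [/\ isproj L /\ size gs = (p * 4 ^ h)%N, L *m P = L /\ \tr (L *m A) = 0,
    orthogonal_family (P - L) gs, \rank L = (4 ^ s * (7 ^ p * N))%N
    & small_blocks A ((2 * s.+1)%:R / (4 ^ h)%:R) (\rank P) gs].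
Proof.
move=> h0 hs; elim: p N P => [|p IH] N P fP tP.
  have [pP rP] := flag_proj fP.
  exists [::], P; rewrite subrr; split=> //; first split=> //.
  - by case: pP.
  - exact: orthogonal_family0.
have [pP rP] := flag_proj fP.
rewrite expnS -mulnA in fP.
have [M [E [cE [rM rE] EP fPE tE]]] := crossfree_extract fP.
rewrite mulnCA in fPE.
have pE := crossfree_proj cE; have pPE := isprojB pP pE EP.
have tE0 : \tr (E *m A) = 0.
  by apply/eqP; have /eqP := tE; rewrite tP mulf_eq0 pnatr_eq0.
have [|gs [L [[pL sgs] [LPE tL] oL rL sm]]] := IH _ _ fPE.
  by rewrite mulmxBl linearB /= tP tE0 subrr.
have hls : (h <= s)%N.
  rewrite -(@leq_exp2l 4) //; apply: leq_trans hs.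
  by rewrite -[leqLHS]muln1 leq_mul2l expn_gt0 orbT.
have EE : (4 ^ s = 4 ^ h * 4 ^ (s - h))%N by rewrite -expnD subnKC.
have x4 : (0 < 4 ^ h)%N by rewrite expn_gt0.
have [||hs' [shs ohs smh]] := @crossfree_blocks R n A A1 s M E h (4 ^ (s - h) * (8 ^ p * N))%N h0 _ cE _ tE0.
- by rewrite rM leq_mul2r; apply/orP; right; rewrite -(leq_pmul2l x4) -EE.
- by rewrite rE (mulnA (4 ^ h)%N) -EE.
have LE : L *m E = 0.
  by rewrite -LPE -mulmxA mulmxBl (subprojC pP pE EP); have [_ ->] := pE; rewrite subrr mulmx0.
exists (hs' ++ gs), L; split.
- by split=> //; rewrite size_cat shs sgs mulSn.
- split=> //; apply: (subproj_trans _ LPE); exact: subprojBl.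
- have -> : P - L = E + (P - E - L) by rewrite addrA [E + _]addrC subrK.
  apply: orthogonal_family_cat => //.
  by rewrite !mulmxBr EP (orthoC pL pE LE); have [_ ->] := pE; rewrite subrr subr0.
- by rewrite rL expnSr -(mulnA (7 ^ p)%N).
- apply: small_blocks_cat; last first.
    by apply: small_blocks_le sm; rewrite mxrank_projB // leq_subr.
  by apply: small_blocks_le smh; rewrite mulnA -EE -rE; exact: mxrank_subproj.
Qed.

(** The first package is kept aside, to absorb what remains after p further
    extractions. *)
Lemma blocks_divisible s h p N P : (0 < h)%N -> (2 * (4 ^ h * 3 ^ s) <= 4 ^ s)%N ->
  (4 ^ s * 7 ^ p.+1 <= 8 ^ p)%N ->
  isproj P -> \rank P = (4 ^ s * 8 ^ p.+1 * N)%N -> \tr (P *m A) = 0 ->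
  exists gs, [/\ size gs = (p.+1 * 4 ^ h)%N, orthogonal_family P gs
    & small_blocks A ((2 * s.+1)%:R / (4 ^ h)%:R) (\rank P) gs].
Proof.
move=> h0 hs hp pP rP tP.
have fP : flag A s (8 * (8 ^ p * N))%N P.
  by apply: flag_exists => //; rewrite rP expnS; lia.
have [M [E [cE [rM rE] EP fPE tE]]] := crossfree_extract fP.
rewrite mulnCA in fPE.
have pE := crossfree_proj cE; have pPE := isprojB pP pE EP.
have tE0 : \tr (E *m A) = 0.
  by apply/eqP; have /eqP := tE; rewrite tP mulf_eq0 pnatr_eq0.
have [||gs [L [[pL sgs] [LPE tL] oL rL sm]]] := flag_blocks h0 _ fPE.
- by apply: leq_trans hs; rewrite leq_pmull.
- by rewrite mulmxBl linearB /= tP tE0 subrr.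
have hls : (h <= s)%N.
  rewrite -(@leq_exp2l 4) //; apply: leq_trans hs.
  by rewrite mulnCA leq_pmulr // muln_gt0 expn_gt0.
have EE : (4 ^ s = 4 ^ h * 4 ^ (s - h))%N by rewrite -expnD subnKC.
have x4 : (0 < 4 ^ h)%N by rewrite expn_gt0.
have LE : L *m E = 0.
  by rewrite -LPE -mulmxA mulmxBl (subprojC pP pE EP); have [_ ->] := pE; rewrite subrr mulmx0.
have EL := orthoC pL pE LE.
have LP : L *m P = L by apply: (subproj_trans _ LPE); exact: subprojBl.
have [M' [cM' rM']] := crossfree_absorb cE pL LE.
pose y := (8 ^ p * N)%N; pose z := (7 ^ p * (7 * N))%N.
have zy : (4 ^ s * z <= y)%N.
  by rewrite /z /y (mulnA (7 ^ p)%N) -expnSr mulnA leq_mul2r hp orbT.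
have rEL : \rank (E + L)%R = (4 ^ h * (4 ^ (s - h) * (y + z)))%N.
  by rewrite mxrank_projD // rE rL (mulnA (4 ^ h)%N) -EE mulnDr.
have [||gs' [sgs' ogs' sm']] := @crossfree_blocks R n A A1 s M' (E + L) h _ h0 _ cM' rEL.
- apply: leq_trans rM' _; rewrite rM rL -/y -/z -(leq_pmul2l x4) [leqRHS]mulnA -EE.
  apply: (@leq_trans (4 ^ h * (3 ^ s * y + 3 ^ s * y))%N).
    by rewrite leq_mul2l leq_add2l leq_mul2l zy !orbT.
  rewrite mulnDr -mulnDl addnn -mul2n.
  apply: (@leq_trans (4 ^ s * y)%N); last by rewrite leq_mul2l leq_addr orbT.
  by rewrite mulnA -(mulnA 2) leq_mul2r hs orbT.
- by rewrite mulmxDl linearD /= tE0 tL addr0.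
exists (gs' ++ gs); split.
- by rewrite size_cat sgs sgs' mulSn.
- have -> : P = (E + L) + (P - E - L) by rewrite addrACA subrr addr0 addrC subrK.
  apply: orthogonal_family_cat => //.
  have [_ iE] := pE; have [_ iL] := pL.
  by rewrite mulmxDl !mulmxBr EP LP EL LE iE iL subrr subr0 subr0 subrr addr0.
- apply: small_blocks_cat; last first.
    by apply: small_blocks_le sm; rewrite mxrank_projB // leq_subr.
  apply: small_blocks_le sm'; rewrite -rEL; apply: mxrank_subproj.
  by rewrite mulmxDl EP LP.
Qed.

(** At each step the rest has trace zero, so its numerical range contains 0. *)
Lemma zero_blocks j P : isproj P -> (j <= \rank P)%N -> \tr (P *m A) = 0 ->
  exists gs Q, [/\ size gs = j, orthogonal_family Q gs,
    Q *m P = Q /\ \rank Q = j, \tr (Q *m A) = 0 & forall x, x \in gs -> x *m A *m x = 0].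
Proof.
move=> pP; elim: j => [|j IH] jP tP.
  exists [::], 0; rewrite mul0mx mxrank0 mul0mx mxtrace0; split=> //.
  exact: orthogonal_family0.
have [gs [Q [sgs oQ [QP rQ] tQ zQ]]] := IH (ltnW jP) tP.
have pQ := orthogonal_family_proj oQ; have pPQ := isprojB pP pQ QP.
have [|w [uw wPQ wA]] := @mean_in_numerical_range _ _ A _ pPQ.
  by rewrite mxrank_projB // rQ subn_gt0.
rewrite mulmxBl linearB /= tP tQ subrr mul0r in wA.
pose x := w^t* *m w; have px : isproj x by exact: isproj_rows.
have wQ : w *m Q = 0.
  rewrite -wPQ -mulmxA; have [_ iQ] := pQ.
  by rewrite mulmxBl (subprojC pP pQ QP) iQ subrr mulmx0.
have wP : w *m P = w by rewrite -{2}wPQ mulmxBr wQ subr0.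
have xQ : x *m Q = 0 by rewrite -mulmxA wQ mulmx0.
exists (x :: gs), (x + Q); split.
- by rewrite /= sgs.
- rewrite -cat1s; apply: orthogonal_family_cat => //; split=> //; last by rewrite big_seq1.
  by move=> z; rewrite inE => /eqP ->.
- split; first by rewrite mulmxDl QP -mulmxA wP.
  by rewrite mxrank_projD // rQ mxrank_rows.
- by rewrite mulmxDl linearD /= mxtrace_row wA tQ addr0.
move=> z; rewrite inE => /orP[/eqP ->|]; last exact: zQ.
rewrite -!mulmxA (mulmxA w A) (mulmxA (w *m A)).
have -> : w *m A *m w^t* = 0; last by rewrite mul0mx mulmx0.
by apply/matrixP => a b; rewrite !ord1 [RHS]mxE.
Qed.

Lemma blocks_exist s h p P : (0 < h)%N -> (2 * (4 ^ h * 3 ^ s) <= 4 ^ s)%N ->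
  (4 ^ s * 7 ^ p.+1 <= 8 ^ p)%N -> isproj P -> \tr (P *m A) = 0 ->
  exists gs zs, [/\ size gs = (p.+1 * 4 ^ h)%N, (size zs < 4 ^ s * 8 ^ p.+1)%N,
    orthogonal_family P (gs ++ zs),
    small_blocks A ((2 * s.+1)%:R / (4 ^ h)%:R) (\rank P) gs
    & forall x, x \in zs -> x *m A *m x = 0].
Proof.
move=> h0 hs hp pP tP.
set q := (4 ^ s * 8 ^ p.+1)%N.
have q0 : (0 < q)%N by rewrite muln_gt0 !expn_gt0.
have [|zs [Q [szs oQ [QP rQ] tQ zQ]]] := @zero_blocks (\rank P %% q)%N P pP _ tP.
  exact: leq_mod.
have pQ := orthogonal_family_proj oQ; have pPQ := isprojB pP pQ QP.
have rPQ : \rank (P - Q)%R = (q * (\rank P %/ q))%N.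
  by rewrite mxrank_projB // rQ {1}(divn_eq (\rank P) q) addnK mulnC.
have [|gs [sgs ogs sm]] := blocks_divisible h0 hs hp pPQ rPQ.
  by rewrite mulmxBl linearB /= tP tQ subrr.
exists gs, zs; split=> //.
- by rewrite szs ltn_mod.
- rewrite -[P](subrK Q); apply: orthogonal_family_cat => //.
  by apply: orthoC => //; exact: subprojB_ortho.
- by apply: small_blocks_le sm; rewrite mxrank_projB // leq_subr.
Qed.

End Decomposition.

(** * Sylvester equations and block assembly *)

Section Assembly.
Variables (R : realType) (n : nat).
Local Notation C := R[i].
Local Notation normc := ComplexField.Normc.normc.
Implicit Types (A P Q X Y B : 'M[C]_n).

(** Isolate b X in the equation and take norms. *)
Lemma sylvester_bound (b : C) (r1 r2 g a : R) B1 B2 X Y :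
  0 <= r1 -> 0 <= r2 -> 0 < g -> 0 <= a -> r1 + r2 + g <= normc b ->
  opb r1 B1 -> opb r2 B2 -> opb a Y -> b *: X + B1 *m X - X *m B2 = Y ->
  opb (a / g) X.
Proof.
move=> r10 r20 g0 a0 bg o1 o2 oY XY.
have b0 : 0 < normc b by apply: lt_le_trans bg; rewrite ltr_wpDl // addr_ge0.
have bn : b != 0.
  by apply: contraTneq b0 => ->; rewrite ComplexField.Normc.normc0 ltxx.
pose c := opnorm X; have c0 : 0 <= c by exact: opnorm_ge0.
have oX : opb c X by exact: opb_opnorm.
have XE : X = b^-1 *: (Y - B1 *m X + X *m B2).
  rewrite -XY addrAC subrK addrK.
  by rewrite scalerA mulVf // scale1r.
have oX' : opb (normc b^-1 * (a + r1 * c + c * r2)) X.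
  rewrite [X in opb _ X]XE; apply: opbZ; apply: opbD; rewrite ?addr_ge0 ?mulr_ge0 //.
    by apply: opbB; rewrite ?mulr_ge0 //; exact: opbM.
  exact: opbM.
have le : c <= normc b^-1 * (a + r1 * c + c * r2).
  by apply: opnorm_le oX'; rewrite mulr_ge0 ?normc_ge0 // !addr_ge0 ?mulr_ge0.
rewrite ComplexField.Normc.normcV mulrC ler_pdivlMr // in le.
apply: opb_le oX; rewrite c0 ler_pdivlMr //=.
have := ler_wpM2l c0 bg; rewrite !mulrDr.
move: le; rewrite (mulrC r1); move: (c * r1) (c * r2) (c * g) (c * normc b) => *; lra.
Qed.

(** The bound shows that the Sylvester operator is injective, hence bijective in
    finite dimension; the solution is then compressed to the block. *)
Lemma sylvester_solution (b : C) (r1 r2 g a : R) P Q B1 B2 Y :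
  0 <= r1 -> 0 <= r2 -> 0 < g -> 0 <= a -> r1 + r2 + g <= normc b ->
  isproj P -> isproj Q -> P *m B1 *m P = B1 -> Q *m B2 *m Q = B2 -> P *m Y *m Q = Y ->
  opb r1 B1 -> opb r2 B2 -> opb a Y ->
  exists X, [/\ P *m X *m Q = X, b *: X + B1 *m X - X *m B2 = Y & opb (a / g) X].
Proof.
move=> r10 r20 g0 a0 bg [_ iP] [_ iQ] B1E B2E YE o1 o2 oY.
(* The matrix of the Sylvester operator, acting on vectorized matrices. *)
pose M := b%:M + lin_mulmx B1 - lin_mulmxr B2 : 'M[C]_(n * n).
have ME X : mxvec X *m M = mxvec (b *: X + B1 *m X - X *m B2).
  by rewrite mulmxBr mulmxDr mul_mx_scalar !mul_vec_lin linearB linearD linearZ.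
have uM : M \in unitmx.
  rewrite -row_free_unit; apply: inj_row_free => v.
  rewrite -[v]vec_mxK ME => /(congr1 vec_mx); rewrite mxvecK linear0 => v0.
  have /opb_small0 -> : opb 0 (vec_mx v).
    by rewrite -(mul0r g^-1); apply: (sylvester_bound r10 r20 g0 (lexx 0) bg o1 o2 _ v0); exact: opb0.
  by rewrite linear0.
pose X0 : 'M[C]_n := vec_mx (mxvec Y *m invmx M).
have X0E : b *: X0 + B1 *m X0 - X0 *m B2 = Y.
  apply: (can_inj mxvecK); rewrite -ME vec_mxK mulmxKV //.
have PB : P *m B1 = B1 *m P by rewrite -B1E -!mulmxA iP !mulmxA iP.
have QB : Q *m B2 = B2 *m Q by rewrite -B2E -!mulmxA iQ !mulmxA iQ.
have XE : b *: (P *m X0 *m Q) + B1 *m (P *m X0 *m Q) - (P *m X0 *m Q) *m B2 = Y.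
  rewrite -[RHS]YE -X0E mulmxBr mulmxBl mulmxDr mulmxDl -scalemxAr -scalemxAl.
  by rewrite !mulmxA PB -!mulmxA QB.
exists (P *m X0 *m Q); split=> //; first by rewrite !mulmxA iP -mulmxA iQ.
exact: (sylvester_bound r10 r20 g0 a0 bg o1 o2 oY XE).
Qed.

(** The blocks of B C - C B are (b_i - b_j) X + B_i X - X B_j off the diagonal, where X is
    a block of C, and B_i C_i - C_i B_i on the diagonal, where the center b_i
    cancels. *)
Lemma commutator_assembly K (P B Cm : nat -> 'M[C]_n) (b : nat -> C) (r : nat -> R)
    (A : 'M[C]_n) (a c g w : R) :
  (forall i, (i < K)%N -> isproj (P i)) ->
  (forall i j, (i < K)%N -> (j < K)%N -> i != j -> P i *m P j = 0) ->
  let S := \sum_(i < K) P i in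
  S *m A *m S = A -> opb a A -> 0 <= a -> 0 < g -> 0 <= c ->
  (forall i, (i < K)%N -> [/\ 0 <= r i, opb (r i) (B i) & opb c (Cm i)]) ->
  (forall i, (i < K)%N -> P i *m B i *m P i = B i /\ P i *m Cm i *m P i = Cm i) ->
  (forall i, (i < K)%N -> P i *m A *m P i = B i *m Cm i - Cm i *m B i) ->
  (forall i, (i < K)%N -> normc (b i) + r i <= w) ->
  (forall i j, (i < K)%N -> (j < K)%N -> i != j -> r i + r j + g <= normc (b i - b j)) ->
  exists BB CC, [/\ S *m BB *m S = BB, S *m CC *m S = CC, A = BB *m CC - CC *m BB,
    opb w BB & opb (c + (K * K)%:R * (a / g)) CC].
Proof.
move=> pP oP S AS oA a0 g0 c0 bnd corner com bw sep.
have iP i : (i < K)%N -> P i *m P i = P i by move=> /pP [].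
have solve (i j : 'I_K) : exists X, i != j ->
    [/\ P i *m X *m P j = X,
        (b i - b j) *: X + B i *m X - X *m B j = P i *m A *m P j & opb (a / g) X].
  have [->|ij] := eqVneq i j; first by exists 0.
  have [r1 o1 _] := bnd i (ltn_ord i); have [r2 o2 _] := bnd j (ltn_ord j).
  have [c1 _] := corner i (ltn_ord i); have [c2 _] := corner j (ltn_ord j).
  have pi := pP i (ltn_ord i); have pj := pP j (ltn_ord j).
  have [||X HX] := @sylvester_solution (b i - b j) (r i) (r j) g a (P i) (P j) (B i) (B j)
    (P i *m A *m P j) r1 r2 g0 a0 (sep i j (ltn_ord i) (ltn_ord j) ij) pi pj c1 c2 _ o1 o2 _.
  - by rewrite !mulmxA iP // -mulmxA iP.
  - rewrite -[a]mulr1; apply: opbM; last exact: opb_proj.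
    by rewrite -[a]mul1r; apply: opbM => //; exact: opb_proj.
  by exists X.
have [X HX] := fin_all_exists (fun i => fin_all_exists (solve i)).
pose T i := b i *: P i + B i.
pose Z (i j : 'I_K) : 'M[C]_n := if i == j then Cm i else X i j.
have ZE (i j : 'I_K) : P i *m Z i j *m P j = Z i j.
  rewrite /Z; case: eqP => [<-|/eqP ij]; first by case: (corner i (ltn_ord i)).
  by case: (HX i j ij).
have PT i : (i < K)%N -> P i *m T i *m P i = T i.
  move=> iK; rewrite mulmxDr mulmxDl -scalemxAr -scalemxAl !iP //.
  by case: (corner i iK) => ->.
have SP i : (i < K)%N -> S *m P i = P i.
  move=> iK; rewrite mulmx_suml (bigD1 (Ordinal iK)) //= iP // big1 ?addr0 // => j ji.
  by apply: oP.
have PS i : (i < K)%N -> P i *m S = P i.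
  move=> iK; rewrite mulmx_sumr (bigD1 (Ordinal iK)) //= iP // big1 ?addr0 // => j ji.
  by apply: oP => //; rewrite eq_sym.
have SE : S = \sum_(i < K) P i by [].
clearbody S.
pose BB := \sum_(i < K) T i; pose CC := \sum_(i < K) \sum_(j < K) Z i j.
have TZ (k i j : 'I_K) : k != i -> T k *m Z i j = 0.
  move=> ki; rewrite -PT // -ZE !mulmxA -(mulmxA _ (P k)) oP //.
  by rewrite mulmx0 !mul0mx.
have ZT (k i j : 'I_K) : j != k -> Z i j *m T k = 0.
  move=> ki; rewrite -PT // -ZE !mulmxA -(mulmxA _ (P j)) oP //.
  by rewrite mulmx0 !mul0mx.
have diag (i j : 'I_K) : T i *m Z i j - Z i j *m T j = P i *m A *m P j.
  have PZ : P i *m Z i j = Z i j by rewrite -[in LHS]ZE !mulmxA iP // ZE.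
  have ZP : Z i j *m P j = Z i j by rewrite -[in LHS]ZE -!mulmxA iP // !mulmxA ZE.
  rewrite mulmxDl mulmxDr -scalemxAl -scalemxAr PZ ZP.
  rewrite opprD addrACA -scalerBl addrA.
  rewrite /Z; case: eqP => [->|/eqP ij]; last by case: (HX i j ij).
  by rewrite subrr scale0r add0r com.
exists BB, CC; split.
- rewrite /BB mulmx_sumr mulmx_suml; apply: eq_bigr => i _.
  rewrite -[in LHS](PT i (ltn_ord i)) !mulmxA SP // -mulmxA PS //.
  exact: PT.
- rewrite /CC mulmx_sumr mulmx_suml; apply: eq_bigr => i _.
  rewrite mulmx_sumr mulmx_suml; apply: eq_bigr => j _.
  by rewrite -[in LHS](ZE i j) !mulmxA SP // -mulmxA PS // ZE.
- have -> : BB *m CC = \sum_(i < K) \sum_(j < K) T i *m Z i j.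
    rewrite /CC mulmx_sumr; apply: eq_bigr => i _; rewrite mulmx_sumr.
    apply: eq_bigr => j _; rewrite /BB mulmx_suml (bigD1 i) //= big1 ?addr0 // => k ki.
    exact: TZ.
  have -> : CC *m BB = \sum_(i < K) \sum_(j < K) Z i j *m T j.
    rewrite /CC mulmx_suml; apply: eq_bigr => i _; rewrite mulmx_suml.
    apply: eq_bigr => j _; rewrite /BB mulmx_sumr (bigD1 j) //= big1 ?addr0 // => k kj.
    by apply: ZT; rewrite eq_sym.
  rewrite -sumrB -[LHS]AS SE !mulmx_suml; apply: eq_bigr => i _.
  by rewrite -sumrB mulmx_sumr; apply: eq_bigr => j _; rewrite diag.
- apply: (opb_blockdiag pP oP PT) => i iK.
  have [r0 oB _] := bnd i iK; apply: opb_le (_ : opb (normc (b i) * 1 + r i) _).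
    by rewrite mulr1 bw // addr_ge0 ?normc_ge0.
  by apply: opbD; rewrite ?mulr1 ?normc_ge0 //; rewrite -[normc _]mulr1; apply/opbZ/opb_proj/pP.
have -> : CC = \sum_(i < K) Cm i + \sum_(i < K) \sum_(j < K) (if i == j then 0 else X i j).
  rewrite -big_split; apply: eq_bigr => i _ /=.
  rewrite (bigD1 i) // [in RHS](bigD1 i) //= eqxx add0r /Z eqxx; congr (_ + _).
  by apply: eq_bigr => j ji; rewrite eq_sym (negPf ji).
have ag0 : 0 <= a / g by rewrite divr_ge0 // ltW.
apply: opbD => //; first by rewrite mulr_ge0.
  apply: (opb_blockdiag pP oP) => i iK; first by case: (corner i iK).
  by case: (bnd i iK).
have -> : (K * K)%:R * (a / g) = \sum_(i < K) \sum_(j < K) (a / g).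
  by rewrite !sumr_const !card_ord -mulrnA mulr_natl.
apply: opb_sum => [i|i]; first by apply: sumr_ge0.
apply: opb_sum => [//|j]; case: eqP => [_|/eqP ij]; first exact: opb0.
by case: (HX i j ij).
Qed.

End Assembly.

Section Centers.
Variable R : realType.
Local Notation normc := ComplexField.Normc.normc.

Lemma normc_Re (x y : R) : `|x| <= normc (x +i* y)%C.
Proof. by rewrite -sqrtr_sqr ler_wsqrtr // lerDl sqr_ge0. Qed.

Lemma normc_Im (x y : R) : `|y| <= normc (x +i* y)%C.
Proof. by rewrite -sqrtr_sqr ler_wsqrtr // lerDr sqr_ge0. Qed.

Lemma normc_ReIm (x y : R) : normc (x +i* y)%C <= `|x| + `|y|.
Proof.
rewrite -(@ler_pXn2r _ 2) ?nnegrE ?addr_ge0 ?sqrtr_ge0 // sqr_sqrtr ?addr_ge0 ?sqr_ge0 //.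
by rewrite sqrrD !real_normK ?num_real // lerD2r lerDl mulrn_wge0 // mulr_ge0.
Qed.

Lemma dist_nat (x y : nat) : x != y -> 1 <= `|x%:R - y%:R : R|.
Proof.
wlog xy : x y / (x < y)%N => [hw|_].
  move=> xy; case: (ltngtP x y) xy => // xy _; last rewrite distrC; apply: hw => //.
    by rewrite neq_ltn xy.
  by rewrite neq_ltn xy.
have xy' : (x <= y)%N := ltnW xy.
by rewrite distrC -natrB // normr_nat ler1n subn_gt0.
Qed.

(** The discs with small radius r sit on a square grid of mesh 4 r, with 2 ^ h rows;
    the points that stand for blocks on which A vanishes are at distance 1 / q from
    each other on the segment from -2 to -1.  One real dimension would not be
    enough: in the application there are more than 4 ^ h discs, and their radius is
    of order h / 4 ^ h. *)
Lemma separated_centers (h p q : nat) (r : R) (G := (p.+1 * 4 ^ h)%N) :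
  0 < r -> 4 * r * (p.+2 * 2 ^ h)%:R <= 1 -> (0 < q)%N ->
  exists b : nat -> R[i],
  [/\ forall i, (i < G + q)%N -> normc (b i) <= 2,
      forall i j, (i < G)%N -> (j < G)%N -> i != j -> 4 * r <= normc (b i - b j),
      forall i j, (i < G)%N -> (G <= j)%N ->
        1 <= normc (b i - b j) /\ 1 <= normc (b j - b i)
    & forall i j, (G <= i)%N -> (G <= j)%N -> i != j -> q%:R^-1 <= normc (b i - b j)].
Proof.
move=> r0 rs q0; pose m := (2 ^ h)%N.
have m0 : (0 < m)%N by rewrite expn_gt0.
have qR : 0 < q%:R :> R by rewrite ltr0n.
have GE : G = (p.+1 * m * m)%N by rewrite /G -mulnA -expnMn.
have r4 : 0 < 4 * r by rewrite mulr_gt0.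
(* Index i < G sits at column i %/ m and row i %% m of the grid. *)
pose f (i : nat) : R[i] := ((4 * r * (i %/ m)%:R) +i* (4 * r * (i %% m)%:R))%C.
pose e (i : nat) : R[i] := ((- 1 - (i - G)%:R / q%:R) +i* 0)%C.
exists (fun i => if (i < G)%N then f i else e i); split.
- move=> i iGq; case: ltnP => iG.
    apply: le_trans (normc_ReIm _ _) _.
    have pos k : 0 <= 4 * r * k%:R by apply: mulr_ge0; rewrite ?(ltW r4) ?ler0n.
    rewrite !ger0_norm ?pos // -mulrDr -natrD.
    apply: (@le_trans _ _ 1); last by rewrite ler1n.
    apply: le_trans rs; rewrite ler_pM2l // ler_nat.
    have := ltn_pmod i m0; have : (i %/ m < p.+1 * m)%N by rewrite ltn_divLR // -GE.
    rewrite -/m; move: (i %/ m)%N (i %% m)%N => x y; nia.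
  apply: le_trans (normc_ReIm _ _) _; rewrite normr0 addr0 -opprD normrN ger0_norm; last first.
    by rewrite addr_ge0 // divr_ge0.
  rewrite -[2](natrD _ 1 1) natrD lerD2l ler_pdivrMr // mul1r ler_nat; lia.
- move=> i j iG jG ij; rewrite iG jG.
  have [dx|dx] := eqVneq (i %/ m)%N (j %/ m)%N.
    have dy : (i %% m)%N != (j %% m)%N.
      by apply: contra_neq ij => dy; rewrite (divn_eq i m) (divn_eq j m) dx dy.
    apply: le_trans (normc_Im (4 * r * (i %/ m)%:R - 4 * r * (j %/ m)%:R) _).
    by rewrite -mulrBr normrM (gtr0_norm r4) ler_pMr // dist_nat.
  apply: le_trans (normc_Re _ (4 * r * (i %% m)%:R - 4 * r * (j %% m)%:R)).
  by rewrite -mulrBr normrM (gtr0_norm r4) ler_pMr // dist_nat.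
- move=> i j iG jG; rewrite iG ltnNge jG /=.
  have x0 : 0 <= 4 * r * (i %/ m)%:R by rewrite mulr_ge0 // ltW.
  have y0 : 0 <= (j - G)%:R / q%:R :> R by rewrite divr_ge0.
  split.
    apply: le_trans (normc_Re _ (4 * r * (i %% m)%:R - 0)).
    by rewrite ger0_norm; lra.
  apply: le_trans (normc_Re _ (0 - 4 * r * (i %% m)%:R)).
  by rewrite ler0_norm; lra.
- move=> i j iG jG ij; rewrite !ltnNge iG jG /=.
  apply: le_trans (normc_Re _ (0 - 0)).
  have -> : - 1 - (i - G)%:R / q%:R - (- 1 - (j - G)%:R / q%:R) =
     ((j - G)%:R - (i - G)%:R) / q%:R :> R by ring.
  rewrite normrM [`|_^-1|]ger0_norm ?invr_ge0 // ler_peMl ?invr_ge0 // dist_nat //.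
  by apply: contra_neq ij => e1; rewrite -(subnK iG) -(subnK jG) e1.
Qed.

End Centers.

(** * Induction on the rank *)

Section Induction.
Variable R : realType.
Local Notation C := R[i].
Local Notation normc := ComplexField.Normc.normc.
Local Notation "x %:C" := (real_complex R x) (at level 1, format "x %:C").

Lemma opb_scale n (x c : R) (A : 'M[C]_n) : 0 <= x -> opb c A -> opb (x * c) (x%:C *: A).
Proof. by move=> x0 /(opbZ x%:C); rewrite normc_real ger0_norm. Qed.

(** The product of the two norms is what matters; the left factor is normalized. *)
Definition bounded_commutator n (k : R) (P A : 'M[C]_n) :=
  exists B Cm, [/\ P *m B *m P = B, P *m Cm *m P = Cm, A = B *m Cm - Cm *m B,
    opb 1 B & opb (k * opnorm A) Cm].

Section Step.
Variables (h s p q : nat) (e r g k : R).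
Hypotheses (h0 : (0 < h)%N) (hs : (2 * (4 ^ h * 3 ^ s) <= 4 ^ s)%N).
Hypotheses (hp : (4 ^ s * 7 ^ p.+1 <= 8 ^ p)%N) (qE : q = (4 ^ s * 8 ^ p.+1)%N).
Local Notation G := (p.+1 * 4 ^ h)%N.
Hypotheses (eE : e = (2 * s.+1)%:R / (4 ^ h)%:R) (e0 : 0 < e) (rE : r = 6 * e).
Hypotheses (r4 : 4 * r <= 1) (rs : 4 * r * (p.+2 * 2 ^ h)%:R <= 1).
Hypotheses (g0 : 0 < g) (gr : g <= r) (gq : g <= q%:R^-1).
Hypothesis kE : k = 6 * (((G + q) * (G + q))%:R / g).

Let q0 : (0 < q)%N. Proof. by rewrite qE muln_gt0 !expn_gt0. Qed.
Let r0 : 0 < r. Proof. by rewrite rE mulr_gt0. Qed.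
Let k0 : 0 < k.
Proof. by rewrite kE !mulr_gt0 ?invr_gt0 // ltr0n muln_gt0 !addn_gt0 q0 orbT. Qed.

(** A block of norm at most e is represented with a left factor of norm r = 6 e and
    thus a right factor of norm at most k e / r = k / 6.  The off-diagonal part
    contributes another k / 6 by the choice of k, so that the product 3 (k / 3) of
    the two bounds is k again. *)
Lemma commutator_step n (P A : 'M[C]_n) : isproj P -> (0 < \rank P)%N ->
  P *m A *m P = A -> \tr A = 0 -> opb 1 A ->
  (forall Q A' : 'M[C]_n, isproj Q -> (\rank Q < \rank P)%N -> Q *m A' *m Q = A' -> \tr A' = 0 ->
     bounded_commutator k Q A') ->
  exists B Cm, [/\ P *m B *m P = B, P *m Cm *m P = Cm, A = B *m Cm - Cm *m B,
    opb 3 B & opb (k / 3) Cm].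
Proof.
move=> pP rP PA tA A1 IH.
have tPA : \tr (P *m A) = 0.
  have [_ iP] := pP; rewrite -PA !mulmxA iP; by rewrite PA.
have [gs [zs [sgs szs ofam sm zz]]] := blocks_exist A1 h0 hs hp pP tPA.
rewrite -qE in szs; rewrite -eE in sm.
set ls := gs ++ zs in ofam; pose K := size ls.
have KE : K = (G + size zs)%N by rewrite /K size_cat sgs.
have KGq : (K <= G + q)%N by rewrite KE leq_add2l ltnW.
pose Pi i := nth 0 ls i.
have [pls ols sls] := ofam.
have Pmem i : (i < K)%N -> Pi i \in ls by move=> iK; rewrite mem_nth.
have pPi i : (i < K)%N -> isproj (Pi i) by move=> /Pmem /pls.
have oPi i j : (i < K)%N -> (j < K)%N -> i != j -> Pi i *m Pi j = 0.
  have lt a b : (a < K)%N -> (b < K)%N -> (a < b)%N -> Pi a *m Pi b = 0.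
    by move=> aK bK ab; have /(pairwiseP 0)/(_ a b aK bK ab)/eqP := ols.
  move=> iK jK; rewrite neq_ltn => /orP[ij|ji]; first exact: lt.
  by apply: orthoC; [exact: pPi | exact: pPi | exact: lt].
have SPi : \sum_(i < K) Pi i = P by rewrite -sls (big_nth 0) big_mkord.
have [b [bn bgg bgz bzz]] := @separated_centers R h p q r r0 rs q0.
pose rr i : R := if (i < G)%N then r else 0.
have sol i : exists BC : 'M[C]_n * 'M[C]_n, (i < K)%N ->
   [/\ 0 <= rr i, opb (rr i) BC.1, opb (k / 6) BC.2 &
   [/\ Pi i *m BC.1 *m Pi i = BC.1, Pi i *m BC.2 *m Pi i = BC.2
     & Pi i *m A *m Pi i = BC.1 *m BC.2 - BC.2 *m BC.1]].
  have [iK|] := ltnP i K; last by exists (0, 0).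
  rewrite /rr; case: ltnP => iG; last first.
    exists (0, 0) => _; split=> //=; try exact: opb0.
    split; rewrite ?mulmx0 ?mul0mx ?subr0 //.
    by apply: zz; rewrite /Pi nth_cat sgs ltnNge iG mem_nth // ltn_subLR // -KE.
  have xgs : Pi i \in gs by rewrite /Pi nth_cat sgs iG mem_nth ?sgs.
  have [tx ox rx] := sm _ xgs; have px := pPi i iK; have [_ ix] := px.
  have [|||B [Cm [cB cC BC oB oC]]] := IH (Pi i) (Pi i *m A *m Pi i) px.
  - by move: rx rP; rewrite mul2n -addnn; lia.
  - by rewrite !mulmxA ix -mulmxA ix.
  - by rewrite mxtrace_mulC mulmxA ix.
  exists (r%:C *: B, r^-1%:C *: Cm) => _ /=; split.
  - exact: (ltW r0).
  - by rewrite -[r in opb r]mulr1; apply: opb_scale; rewrite ?(ltW r0).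
  - apply: opb_le (_ : opb (r^-1 * (k * opnorm (Pi i *m A *m Pi i))) _); last first.
      by apply: opb_scale => //; rewrite invr_ge0 (ltW r0).
    rewrite mulr_ge0 ?invr_ge0 ?(ltW r0) ?mulr_ge0 ?(ltW k0) ?opnorm_ge0 //=.
    rewrite ler_pdivrMl // mulrCA ler_pM2l // mulrC.
    have : opnorm (Pi i *m A *m Pi i) <= e by apply: opnorm_le => //; exact: (ltW e0).
    by rewrite rE mulKf // pnatr_eq0.
  split.
  - by rewrite -scalemxAr -scalemxAl cB.
  - by rewrite -scalemxAr -scalemxAl cC.
  - rewrite -!scalemxAl -!scalemxAr !scalerA -!rmorphM /= mulfV ?gt_eqF //.
    by rewrite mulVf ?gt_eqF // rmorph1 !scale1r.
have {sol} [BC HBC] := choice sol.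
have [|||||||BB [CC [cB cC ABC oB oC]]] := @commutator_assembly R n K Pi (fun i => (BC i).1)
  (fun i => (BC i).2) b rr A 1 (k / 6) g 3 pPi oPi _ A1 ler01 g0.
- by rewrite SPi.
- by rewrite divr_ge0 // (ltW k0).
- by move=> i /HBC [].
- by move=> i /HBC [_ _ _ []].
- by move=> i /HBC [_ _ _ []].
- move=> i iK; have := bn i (leq_trans iK KGq); rewrite /rr; have := r4.
  by case: ifP => _; lra.
- move=> i j iK jK ij; rewrite /rr; have := r4; have := gr; have := gq; have := r0.
  case: (ltnP i G) => iG; case: (ltnP j G) => jG.
  + by have := bgg i j iG jG ij; lra.
  + by have [] := bgz i j iG jG; lra.
  + by have [] := bgz j i jG iG; lra.
  + by have := bzz i j iG jG ij; lra.
rewrite SPi in cB cC.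
exists BB, CC; split=> //; apply: opb_le oC.
have KK : (K * K)%:R <= ((G + q) * (G + q))%:R :> R by rewrite ler_nat leq_mul.
rewrite addr_ge0 ?divr_ge0 ?(ltW k0) ?mulr_ge0 ?invr_ge0 ?(ltW g0) //=.
have -> : k / 3 = k / 6 + ((G + q) * (G + q))%:R * (1 / g).
  by rewrite kE div1r; field; rewrite gt_eqF.
by rewrite lerD2l ler_wpM2r // divr_ge0 // (ltW g0).
Qed.

Lemma bounded_commutator_exists n (P A : 'M[C]_n) : isproj P ->
  P *m A *m P = A -> \tr A = 0 -> bounded_commutator k P A.
Proof.
have [N] := ubnP (\rank P); elim: N P A => // N IH P A; rewrite ltnS => rN pP PA tA.
have kA : 0 <= k * opnorm A by rewrite mulr_ge0 ?opnorm_ge0 // (ltW k0).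
have zero : A = 0 -> bounded_commutator k P A.
  move=> A0; exists 0, 0; rewrite A0 !mulmx0 mul0mx subr0.
  by split=> //; exact: opb0.
(* Reduce to norm 1; the left factor of norm 3 is renormalized at the end. *)
have [a0|a0] := eqVneq (opnorm A) 0.
  by apply: zero; apply: opb_small0; rewrite -a0; exact: opb_opnorm.
have [rP|rP] := posnP (\rank P).
  by apply: zero; rewrite -PA (_ : P = 0) ?mulmx0 //; apply/eqP; rewrite -mxrank_eq0 rP.
set a := opnorm A in a0 kA; have ap : 0 < a by rewrite lt_def a0 opnorm_ge0.
have [|||Q A' pQ rQ QA tA'|B [Cm [cB cC BC oB oC]]] :=
  @commutator_step n P (a^-1%:C *: A) pP rP.
- by rewrite -scalemxAr -scalemxAl PA.
- by rewrite linearZ /= tA mulr0.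
- by rewrite -(mulVf a0); apply: opb_scale; [rewrite invr_ge0 ltW | exact: opb_opnorm].
- by apply: IH => //; exact: leq_trans rN.
exists (3^-1%:C *: B), ((3 * a)%:C *: Cm); split.
- by rewrite -scalemxAr -scalemxAl cB.
- by rewrite -scalemxAr -scalemxAl cC.
- rewrite -!scalemxAl -!scalemxAr !scalerA -!rmorphM /= [3 * a / 3]mulrC mulKf ?pnatr_eq0 //.
  by rewrite -scalerBr -BC scalerA -rmorphM mulfV // rmorph1 scale1r.
- by apply: (opb_le _ (opb_scale _ oB)); rewrite ?invr_ge0 ?ler0n // mulVf ?pnatr_eq0 // ler01 lexx.
- have -> : k * opnorm A = 3 * a * (k / 3) by rewrite -/a; field.
  by apply: opb_scale => //; rewrite mulr_ge0 // ltW.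
Qed.

End Step.

Lemma bounded_commutator_constant h s p : (0 < h)%N ->
  (2 * (4 ^ h * 3 ^ s) <= 4 ^ s)%N -> (4 ^ s * 7 ^ p.+1 <= 8 ^ p)%N ->
  (48 * (s.+1 * p.+2) <= 2 ^ h)%N ->
  exists2 k : R, 0 < k & forall n (P A : 'M[C]_n), isproj P ->
    P *m A *m P = A -> \tr A = 0 -> bounded_commutator k P A.
Proof.
move=> h0 hs hp hsp.
have [q qE] : exists q, q = (4 ^ s * 8 ^ p.+1)%N by exists (4 ^ s * 8 ^ p.+1)%N.
have q0 : (0 < q)%N by rewrite qE muln_gt0 !expn_gt0.
have qR : 0 < q%:R :> R by rewrite ltr0n.
have [e eE] : exists e : R, e = (2 * s.+1)%:R / (4 ^ h)%:R.
  by exists ((2 * s.+1)%:R / (4 ^ h)%:R).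
have e0 : 0 < e by rewrite eE divr_gt0 // ltr0n // expn_gt0.
have [r rE] : exists r : R, r = 6 * e by exists (6 * e).
have r0 : 0 < r by rewrite rE mulr_gt0.
have rs : 4 * r * (p.+2 * 2 ^ h)%:R <= 1.
  have m0 : (2 ^ h)%:R != 0 :> R by rewrite pnatr_eq0 -lt0n expn_gt0.
  rewrite rE eE; have -> : (4 ^ h)%:R = (2 ^ h)%:R * (2 ^ h)%:R :> R.
    by rewrite -natrM -expnMn.
  rewrite !natrM.
  have -> : 4 * (6 * (2 * s.+1%:R / ((2 ^ h)%:R * (2 ^ h)%:R))) * (p.+2%:R * (2 ^ h)%:R)
    = (48 * (s.+1%:R * p.+2%:R)) / (2 ^ h)%:R :> R by field.
  rewrite ler_pdivrMr ?ltr0n ?expn_gt0 // mul1r.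
  by rewrite -!natrM ler_nat.
have r4 : 4 * r <= 1.
  apply: le_trans rs; apply: ler_peMr; last by rewrite ler1n muln_gt0 expn_gt0.
  by apply: mulr_ge0; rewrite ?(ltW r0) ?ler0n.
have g0 : 0 < r / q%:R by rewrite divr_gt0.
have gr : r / q%:R <= r.
  by rewrite ler_pdivrMr //; apply: ler_peMr; rewrite ?(ltW r0) ?ler1n.
have gq : r / q%:R <= q%:R^-1.
  by rewrite ler_pdivrMr // mulVf ?gt_eqF //; lra.
exists (6 * (((p.+1 * 4 ^ h + q) * (p.+1 * 4 ^ h + q))%:R / (r / q%:R))).
  by rewrite !mulr_gt0 ?invr_gt0 // ltr0n muln_gt0 !addn_gt0 q0 orbT.
move=> n P A; exact: (@bounded_commutator_exists h s p q e r (r / q%:R)).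
Qed.

End Induction.

Theorem theorem1p1 (R : realType) :
  exists K : R, 0 < K /\
    forall (n : nat) (A : 'M[R[i]]_n), (1 <= n)%N -> \tr A = 0 ->
      exists B C : 'M[R[i]]_n,
        A = B *m C - C *m B /\ opnorm B * opnorm C <= K * opnorm A.
Proof.
have [h [s [p [h0 hs hp hsp]]]] := parameters_exist.
have [K K0 HK] := bounded_commutator_constant R h0 hs hp hsp.
exists K; split=> // n A _ tA.
have [|B [Cm [_ _ BC oB oC]]] := HK n 1%:M A (isproj1 _ n) _ tA.
  by rewrite mul1mx mulmx1.
exists B, Cm; split=> //; rewrite -[leRHS]mul1r.
have kA : 0 <= K * opnorm A by rewrite mulr_ge0 ?opnorm_ge0 // ltW.
by apply: ler_pM; rewrite ?opnorm_ge0 //; apply: opnorm_le.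
Qed.
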